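(* Let $C$ be a symmetrizable generalized Cartan matrix. In the presheaf category $\mathrm{Pre}_2(C)$, every left-bounded and locally finite coproduct of objects of $\mathcal A_2(C)$ is a biproduct.
   Context: **Cartan data.** $\mathbb N=\mathbb Z_{\ge0}$. $\mathbb K$ is a field and $(C_{ij})_{i,j\in I}$ a symmetrizable generalized Cartan matrix: $I$ finite, $C_{ii}=2$, $C_{ij}\in\mathbb Z_{\le0}$ for $i\ne j$, $C_{ij}=0\iff C_{ji}=0$, with relatively prime positive integers $d_i$ such that $d_iC_{ij}=d_jC_{ji}$. Fix $t_{ij}\in\mathbb K^\times$ ($i\ne j$) and $s_{ij;pr}\in\mathbb K$ ($0\le p<-C_{ij}$, $0\le r<-C_{ji}$) with $s_{ij;pr}=s_{ji;rp}$, $t_{ij}=t_{ji}$ if $C_{ij}=0$, and $s_{ij;pr}=0$ unless $d_ip+d_jr=-d_iC_{ij}$. Put $Q_{ii}=0$, $Q_{ij}=t_{ij}$ if $i\ne j$ and $C_{ij}=0$, and otherwise $Q_{ij}(u,v)=t_{ij}u^{-C_{ij}}+\sum_{p,r}s_{ij;pr}u^pv^r+t_{ji}v^{-C_{ji}}$. **The category $\mathcal A_2(C)$.** $\mathcal A_2(Q)$ is the strict monoidal $\mathbb K$-linear category (product by juxtaposition, unit $\mathbf 1$, identities denoted by the object) generated by objects $E_i,F_i$ ($i\in I$) and morphisms $X_i:E_i\to E_i$, $T_{ij}:E_iE_j\to E_jE_i$, $\eta_i:\mathbf 1\to F_iE_i$, $\epsilon_i:E_iF_i\to\mathbf 1$,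 with relations: $(\epsilon_iE_i)\circ(E_i\eta_i)=E_i$, $(F_i\epsilon_i)\circ(\eta_iF_i)=F_i$; $T_{ij}\circ X_iE_j-E_jX_i\circ T_{ij}=X_jE_i\circ T_{ij}-T_{ij}\circ E_iX_j=\delta_{ij}E_iE_j$; $T_{ij}\circ T_{ji}=Q_{ij}(E_jX_i,X_jE_i)$; $T_{jk}E_i\circ E_jT_{ik}\circ T_{ij}E_k-E_kT_{ij}\circ T_{ik}E_j\circ E_iT_{jk}=\delta_{ik}\frac{Q_{ij}(X_iE_j,E_iX_j)E_i-E_iQ_{ij}(E_jX_i,X_jE_i)}{X_iE_jE_i-E_iE_jX_i}$. Morphisms are graded by $\deg X_i=2d_i$, $\deg T_{ij}=-d_iC_{ij}$, $\deg\eta_i=\deg\epsilon_i=0$. Objects of $\mathcal A_2(C)$ are formal shifts $q^nX$ ($n\in\mathbb Z$) of words $X$ in the $E_i,F_i$; $\mathrm{Hom}_{\mathcal A_2(C)}(q^nX,q^mY)$ is the degree $n-m$ part of $\mathrm{Hom}_{\mathcal A_2(Q)}(X,Y)$. **Presheaves and coproducts.** $\mathrm{Pre}_2(C)$ is the category of ($\mathbb K$-linear) functors $\mathcal A_2(C)^{op}\to\mathbb K\text{-Vec}$; $\mathcal A_2(C)$ is viewed in it by the Yoneda embedding, and the shift is $(qF)(X)=F(q^{-1}X)$. A coproduct is locally finite if it has the form $\coprod_{l\in\mathbb Z}q^l(F_1^{\oplus k_{1,l}}\oplus\cdots\oplus F_n^{\oplus k_{n,l}})$ for finitely many objects $F_1,\dots,F_n$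 and $k_{m,l}\in\mathbb N$; it is left-bounded if there is $l_0\in\mathbb Z$ with $k_{m,l}=0$ for all $m$ whenever $l<l_0$. It is a coproduct of objects of $\mathcal A_2(C)$ if all $F_m\in\mathcal A_2(C)$. A coproduct of objects $Y_s$ is a biproduct if the canonical map $\coprod_sY_s\to\prod_sY_s$ (identity on diagonal components, zero elsewhere) is an isomorphism. *)

(* Defs.v *)
From HB Require Import structures.
From mathcomp Require Import all_boot all_order all_algebra.
From mathcomp Require Import boolp.

Set Implicit Arguments.
Unset Strict Implicit.
Unset Printing Implicit Defensive.

Import Order.TTheory GRing.Theory Num.Theory.
Local Open Scope ring_scope.
Local Open Scope quotient_scope.

(* Since C i j <= 0 off the diagonal, - C i j is the natural number `|C i j|. *)
(* For empty I the gcd is 0, hence the guard in [symd_coprime].               *)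
Record sym_cartan (I : finType) := SymCartan {
  cartan :> I -> I -> int;
  symd : I -> nat;
  cartan_diag : forall i, cartan i i = 2%:Z;
  cartan_offdiag : forall i j, i != j -> cartan i j <= 0;
  cartan_eq0 : forall i j, cartan i j = 0 <-> cartan j i = 0;
  symd_gt0 : forall i, (0 < symd i)%N;
  symd_coprime : (0 < #|I|)%N -> \big[gcdn/0%N]_(i : I) symd i = 1%N;
  symdC : forall i j, (symd i)%:Z * cartan i j = (symd j)%:Z * cartan j i
}.

(* The scalars t_ij and s_ij;pr are meaningful for i != j, p < - C i j and    *)
(* r < - C j i only; no condition is imposed on the other values, which are   *)
(* never used.                                                                *)
Record qdata (K : fieldType) (I : finType) (C : sym_cartan I) := QData {
  qt : I -> I -> K;
  qs : I -> I -> nat -> nat -> K;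
  qt_neq0 : forall i j, i != j -> qt i j != 0;
  qt_sym : forall i j, i != j -> C i j = 0 -> qt i j = qt j i;
  qs_sym : forall i j p r, i != j -> (p < `|C i j|)%N -> (r < `|C j i|)%N ->
    qs i j p r = qs j i r p;
  qs_homog : forall i j p r, i != j -> (p < `|C i j|)%N -> (r < `|C j i|)%N ->
    (symd C i * p + symd C j * r)%:Z <> - ((symd C i)%:Z * C i j) ->
    qs i j p r = 0
}.

(* Q_ij(u,v), with u the outer variable of {poly {poly K}} and v the inner    *)
(* one.                                                                       *)
Definition Qpoly (K : fieldType) (I : finType) (C : sym_cartan I)
    (D : qdata K C) (i j : I) : {poly {poly K}} :=
  if i == j then 0
  else if C i j == 0 then (qt D i j)%:P%:P
  else (qt D i j)%:P *: 'X^(`|C i j|)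
       + \sum_(p < `|C i j|) \sum_(r < `|C j i|)
           (qs D i j p r *: 'X^r) *: 'X^p
       + (qt D j i *: 'X^(`|C j i|))%:P.

(* The polynomial (q(u,v) - q(w,v)) / (u - w) in the variables u, w, v, from  *)
(* the outermost to the innermost; see [ddiffP].                              *)
Definition ddiff (K : fieldType) (q : {poly {poly K}}) :
    {poly {poly {poly K}}} :=
  \sum_(p < size q) (q`_p)%:P%:P * \sum_(a < p) 'X%:P ^+ (p.-1 - a) * 'X^a.

Lemma ddiffP (K : fieldType) (q : {poly {poly K}}) :
  ('X - 'X%:P) * ddiff q = map_poly polyC q - q%:P.
Proof.
have qE : q = \sum_(p < size q) q`_p *: 'X^p by rewrite -[LHS]coefK poly_def.
have -> : map_poly polyC q = \sum_(p < size q) (q`_p)%:P%:P * 'X^p.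
  rewrite [in LHS]qE rmorph_sum; apply: eq_bigr => p _ /=.
  by rewrite -mul_polyC rmorphM /= map_polyC map_polyXn.
have -> : q%:P = \sum_(p < size q) (q`_p *: 'X^p)%:P.
  by rewrite [in LHS]qE rmorph_sum.
rewrite -sumrB /ddiff mulr_sumr.
apply: eq_bigr => p _ /=; rewrite -mul_polyC polyCM -mulrBr polyC_exp mulrCA.
congr (_ * _); rewrite -[X in X * _]opprB mulNr -[RHS]opprB; congr (- _).
by rewrite subrXX; congr (_ * _); apply: eq_bigr => a _; rewrite -subn1 -subnDA add1n.
Qed.

Inductive gen (I : Type) := genE of I | genF of I.

(* The tensor product of objects is concatenation of words.                   *)
Definition word (I : Type) := seq (gen I).

Inductive tm (K : fieldType) (I : Type) : word I -> word I -> Type :=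
| tm_id X : tm K X X
| tm_comp X Y Z of tm K Y Z & tm K X Y : tm K X Z
| tm_tens X Y X' Y' of tm K X Y & tm K X' Y' : tm K (X ++ X') (Y ++ Y')
| tm_zero X Y : tm K X Y
| tm_add X Y of tm K X Y & tm K X Y : tm K X Y
| tm_scale X Y of K & tm K X Y : tm K X Y
| tm_X i : tm K [:: genE i] [:: genE i]
| tm_T i j : tm K [:: genE i; genE j] [:: genE j; genE i]
| tm_eta i : tm K [::] [:: genF i; genE i]
| tm_eps i : tm K [:: genE i; genF i] [::].

Arguments tm_id {K I}.
Arguments tm_zero {K I}.
Arguments tm_X {K I}.
Arguments tm_T {K I}.
Arguments tm_eta {K I}.
Arguments tm_eps {K I}.

Declare Scope tm_scope.
Delimit Scope tm_scope with T.
Local Infix "∘" := tm_comp (at level 40, left associativity) : tm_scope.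
Local Infix "⊗" := tm_tens (at level 34, right associativity) : tm_scope.
Local Notation "f + g" := (tm_add f g) : tm_scope.
Local Notation "a *: f" := (tm_scale a f) : tm_scope.
Local Notation "f - g" := (tm_add f (tm_scale (-1) g)) : tm_scope.
Local Notation "1" := (tm_id _) : tm_scope.
Local Notation "0" := (tm_zero _ _) : tm_scope.
Local Notation idE i := (tm_id [:: genE i]).
Local Notation idF i := (tm_id [:: genF i]).

Section Terms.
Variables (K : fieldType) (I : Type).
Implicit Types X Y : word I.
Local Open Scope tm_scope.

(* Strictness: juxtaposition of words is associative and unital only up to a  *)
(* propositional equality, along which terms are transported.                 *)
Definition tm_cast X X' Y Y' (eX : X = X') (eY : Y = Y') (f : tm K X Y) :
    tm K X' Y' :=
  match eX in _ = A, eY in _ = B return tm K A B with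
  | erefl, erefl => f
  end.

Definition tm_pow X (f : tm K X X) (n : nat) : tm K X X :=
  iter n (tm_comp f) 1.

Definition tm_sum X Y n (f : 'I_n -> tm K X Y) : tm K X Y :=
  \big[@tm_add K I X Y/0]_(i < n) f i.

(* q(u,v) for commuting endomorphisms u and v.                                *)
Definition tm_eval2 X (q : {poly {poly K}}) (u v : tm K X X) : tm K X X :=
  tm_sum (fun p : 'I_(size q) => tm_sum (fun r : 'I_(size q`_p) =>
    q`_p`_r *: (tm_pow u p ∘ tm_pow v r))).

(* q(u,w,v) for commuting endomorphisms u, w and v.                           *)
Definition tm_eval3 X (q : {poly {poly {poly K}}}) (u w v : tm K X X) :
    tm K X X :=
  tm_sum (fun a : 'I_(size q) => tm_sum (fun b : 'I_(size q`_a) =>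
    tm_sum (fun c : 'I_(size q`_a`_b) =>
      q`_a`_b`_c *: (tm_pow u a ∘ tm_pow w b ∘ tm_pow v c)))).

End Terms.

Section Relations.
Variables (K : fieldType) (I : finType) (C : sym_cartan I) (D : qdata K C).
Implicit Types X Y Z : word I.
Local Open Scope tm_scope.

(* The smallest congruence for which terms form a strict monoidal K-linear    *)
(* category satisfying the relations rel_* of A_2(Q). The relations with a    *)
(* factor delta_ij are split into two cases because the identity which it     *)
(* multiplies has the required source and target only for i = j.              *)
Inductive tm_eqv : forall X Y, tm K X Y -> tm K X Y -> Prop :=
| eqv_refl X Y (f : tm K X Y) : tm_eqv f f
| eqv_sym X Y (f g : tm K X Y) : tm_eqv f g -> tm_eqv g f
| eqv_trans X Y (f g h : tm K X Y) : tm_eqv f g -> tm_eqv g h -> tm_eqv f h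
| eqv_comp X Y Z (f f' : tm K Y Z) (g g' : tm K X Y) :
    tm_eqv f f' -> tm_eqv g g' -> tm_eqv (f ∘ g) (f' ∘ g')
| eqv_tens X Y X' Y' (f f' : tm K X Y) (g g' : tm K X' Y') :
    tm_eqv f f' -> tm_eqv g g' -> tm_eqv (f ⊗ g) (f' ⊗ g')
| eqv_add X Y (f f' g g' : tm K X Y) :
    tm_eqv f f' -> tm_eqv g g' -> tm_eqv (f + g) (f' + g')
| eqv_scale X Y a (f f' : tm K X Y) : tm_eqv f f' -> tm_eqv (a *: f) (a *: f')
| eqv_addA X Y (f g h : tm K X Y) : tm_eqv (f + (g + h)) (f + g + h)
| eqv_addC X Y (f g : tm K X Y) : tm_eqv (f + g) (g + f)
| eqv_add0 X Y (f : tm K X Y) : tm_eqv (0 + f) f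
| eqv_addN X Y (f : tm K X Y) : tm_eqv (f - f) 0
| eqv_scaleA X Y a b (f : tm K X Y) : tm_eqv (a *: (b *: f)) ((a * b)%R *: f)
| eqv_scale1 X Y (f : tm K X Y) : tm_eqv (1%R *: f) f
| eqv_scaleDr X Y a (f g : tm K X Y) : tm_eqv (a *: (f + g)) (a *: f + a *: g)
| eqv_scaleDl X Y a b (f : tm K X Y) : tm_eqv ((a + b)%R *: f) (a *: f + b *: f)
| eqv_compA W X Y Z (f : tm K Y Z) (g : tm K X Y) (h : tm K W X) :
    tm_eqv (f ∘ (g ∘ h)) (f ∘ g ∘ h)
| eqv_comp1l X Y (f : tm K X Y) : tm_eqv (1 ∘ f) f
| eqv_comp1r X Y (f : tm K X Y) : tm_eqv (f ∘ 1) f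
| eqv_compDl X Y Z (f f' : tm K Y Z) (g : tm K X Y) :
    tm_eqv ((f + f') ∘ g) (f ∘ g + f' ∘ g)
| eqv_compDr X Y Z (f : tm K Y Z) (g g' : tm K X Y) :
    tm_eqv (f ∘ (g + g')) (f ∘ g + f ∘ g')
| eqv_compZl X Y Z a (f : tm K Y Z) (g : tm K X Y) :
    tm_eqv ((a *: f) ∘ g) (a *: (f ∘ g))
| eqv_compZr X Y Z a (f : tm K Y Z) (g : tm K X Y) :
    tm_eqv (f ∘ (a *: g)) (a *: (f ∘ g))
| eqv_tensDl X Y X' Y' (f f' : tm K X Y) (g : tm K X' Y') :
    tm_eqv ((f + f') ⊗ g) (f ⊗ g + f' ⊗ g)
| eqv_tensDr X Y X' Y' (f : tm K X Y) (g g' : tm K X' Y') :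
    tm_eqv (f ⊗ (g + g')) (f ⊗ g + f ⊗ g')
| eqv_tensZl X Y X' Y' a (f : tm K X Y) (g : tm K X' Y') :
    tm_eqv ((a *: f) ⊗ g) (a *: (f ⊗ g))
| eqv_tensZr X Y X' Y' a (f : tm K X Y) (g : tm K X' Y') :
    tm_eqv (f ⊗ (a *: g)) (a *: (f ⊗ g))
| eqv_tens11 X X' : tm_eqv (tm_id X ⊗ tm_id X') (tm_id (X ++ X'))
| eqv_interchange X Y Z X' Y' Z'
    (f : tm K Y Z) (g : tm K X Y) (f' : tm K Y' Z') (g' : tm K X' Y') :
    tm_eqv ((f ∘ g) ⊗ (f' ∘ g')) ((f ⊗ f') ∘ (g ⊗ g'))
| eqv_tensA X Y X' Y' X'' Y''
    (f : tm K X Y) (g : tm K X' Y') (h : tm K X'' Y'') :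
    tm_eqv (tm_cast (catA X X' X'') (catA Y Y' Y'') (f ⊗ (g ⊗ h)))
           ((f ⊗ g) ⊗ h)
| eqv_tens1l X Y (f : tm K X Y) : tm_eqv (tm_id [::] ⊗ f) f
| eqv_tens1r X Y (f : tm K X Y) :
    tm_eqv (tm_cast (cats0 X) (cats0 Y) (f ⊗ tm_id [::])) f
| rel_adjE i : tm_eqv ((tm_eps i ⊗ idE i) ∘ (idE i ⊗ tm_eta i)) (idE i)
| rel_adjF i : tm_eqv ((idF i ⊗ tm_eps i) ∘ (tm_eta i ⊗ idF i)) (idF i)
| rel_TXl i j : i != j ->
    tm_eqv (tm_T i j ∘ (tm_X i ⊗ idE j) - (idE j ⊗ tm_X i) ∘ tm_T i j) 0
| rel_TXr i j : i != j ->
    tm_eqv ((tm_X j ⊗ idE i) ∘ tm_T i j - tm_T i j ∘ (idE i ⊗ tm_X j)) 0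
| rel_TXl_diag i :
    tm_eqv (tm_T i i ∘ (tm_X i ⊗ idE i) - (idE i ⊗ tm_X i) ∘ tm_T i i)
           (idE i ⊗ idE i)
| rel_TXr_diag i :
    tm_eqv ((tm_X i ⊗ idE i) ∘ tm_T i i - tm_T i i ∘ (idE i ⊗ tm_X i))
           (idE i ⊗ idE i)
| rel_TT i j :
    tm_eqv (tm_T i j ∘ tm_T j i)
           (tm_eval2 (Qpoly D i j) (idE j ⊗ tm_X i) (tm_X j ⊗ idE i))
| rel_braid i j k : i != k ->
    tm_eqv ((tm_T j k ⊗ idE i) ∘ (idE j ⊗ tm_T i k) ∘ (tm_T i j ⊗ idE k)
            - (idE k ⊗ tm_T i j) ∘ (tm_T i k ⊗ idE j) ∘ (idE i ⊗ tm_T j k))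
           0
| rel_braid_diag i j :
    tm_eqv ((tm_T j i ⊗ idE i) ∘ (idE j ⊗ tm_T i i) ∘ (tm_T i j ⊗ idE i)
            - (idE i ⊗ tm_T i j) ∘ (tm_T i i ⊗ idE j) ∘ (idE i ⊗ tm_T j i))
           (tm_eval3 (ddiff (Qpoly D i j))
              (tm_X i ⊗ idE j ⊗ idE i) (idE i ⊗ idE j ⊗ tm_X i)
              (idE i ⊗ tm_X j ⊗ idE i)).

Inductive tm_homog : forall X Y, int -> tm K X Y -> Prop :=
| homog_id X : tm_homog 0%R (tm_id X)
| homog_comp X Y Z d e (f : tm K Y Z) (g : tm K X Y) :
    tm_homog d f -> tm_homog e g -> tm_homog (d + e)%R (f ∘ g)
| homog_tens X Y X' Y' d e (f : tm K X Y) (g : tm K X' Y') :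
    tm_homog d f -> tm_homog e g -> tm_homog (d + e)%R (f ⊗ g)
| homog_zero X Y d : tm_homog d (tm_zero X Y)
| homog_add X Y d (f g : tm K X Y) :
    tm_homog d f -> tm_homog d g -> tm_homog d (f + g)
| homog_scale X Y d a (f : tm K X Y) : tm_homog d f -> tm_homog d (a *: f)
| homog_X i : tm_homog (2 * symd C i)%:Z (tm_X i)
| homog_T i j : tm_homog (- ((symd C i)%:Z * C i j))%R (tm_T i j)
| homog_eta i : tm_homog 0%R (tm_eta i)
| homog_eps i : tm_homog 0%R (tm_eps i).

End Relations.

Record lincat (K : fieldType) := LinCat {
  lc_obj :> Type;
  lc_hom : lc_obj -> lc_obj -> lmodType K;
  lc_id : forall X, lc_hom X X;
  lc_comp : forall X Y Z, lc_hom Y Z -> lc_hom X Y -> lc_hom X Z;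
  lc_compA : forall W X Y Z (f : lc_hom Y Z) (g : lc_hom X Y) (h : lc_hom W X),
    lc_comp f (lc_comp g h) = lc_comp (lc_comp f g) h;
  lc_comp1l : forall X Y (f : lc_hom X Y), lc_comp (lc_id Y) f = f;
  lc_comp1r : forall X Y (f : lc_hom X Y), lc_comp f (lc_id X) = f;
  lc_compl_linear : forall X Y Z (g : lc_hom X Y),
    linear (fun f : lc_hom Y Z => lc_comp f g);
  lc_compr_linear : forall X Y Z (f : lc_hom Y Z),
    linear (fun g : lc_hom X Y => lc_comp f g)
}.

Arguments lc_id {K l}.

Section A2.
Variables (K : fieldType) (I : finType) (C : sym_cartan I) (D : qdata K C).
Implicit Types X Y Z : word I.

Section Hom.
Variables X Y : word I.

HB.instance Definition _ := gen_eqMixin (tm K X Y).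
HB.instance Definition _ := gen_choiceMixin (tm K X Y).

Definition tm_eqvb (f g : tm K X Y) : bool := `[< tm_eqv D f g >].

Lemma tm_eqvb_refl : reflexive tm_eqvb.
Proof. by move=> f; apply/asboolP; apply: eqv_refl. Qed.

Lemma tm_eqvb_sym : symmetric tm_eqvb.
Proof. by move=> f g; apply/asboolP/asboolP; apply: eqv_sym. Qed.

Lemma tm_eqvb_trans : transitive tm_eqvb.
Proof.
by move=> g f h /asboolP fg /asboolP gh; apply/asboolP; apply: eqv_trans gh.
Qed.

Canonical tm_eqv_equiv :=
  EquivRel tm_eqvb tm_eqvb_refl tm_eqvb_sym tm_eqvb_trans.

Definition A2Q_hom := {eq_quot tm_eqv_equiv}.

HB.instance Definition _ := Choice.on A2Q_hom.
HB.instance Definition _ := EqQuotient.on A2Q_hom.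

Definition tm_class (f : tm K X Y) : A2Q_hom := \pi_A2Q_hom f.

Lemma tm_classP f g : tm_class f = tm_class g <-> tm_eqv D f g.
Proof.
rewrite /tm_class; split => [/eqmodP/asboolP //|fg].
by apply/eqmodP/asboolP.
Qed.

Lemma tm_classK (h : A2Q_hom) : tm_class (repr h) = h.
Proof. exact: reprK. Qed.

Lemma tm_repr f : tm_eqv D (repr (tm_class f)) f.
Proof. by apply/tm_classP; rewrite tm_classK. Qed.

Definition A2Q_zero : A2Q_hom := tm_class (tm_zero X Y).
Definition A2Q_add (f g : A2Q_hom) := tm_class (tm_add (repr f) (repr g)).
Definition A2Q_scale a (f : A2Q_hom) := tm_class (tm_scale a (repr f)).
Definition A2Q_opp (f : A2Q_hom) := A2Q_scale (-1) f.

Lemma tm_class_add f g :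
  tm_class (tm_add f g) = A2Q_add (tm_class f) (tm_class g).
Proof. by apply/tm_classP; apply: eqv_add; apply: eqv_sym; exact: tm_repr. Qed.

Lemma tm_class_scale a f :
  tm_class (tm_scale a f) = A2Q_scale a (tm_class f).
Proof. by apply/tm_classP; apply: eqv_scale; apply: eqv_sym; exact: tm_repr. Qed.

Lemma A2Q_addA : associative A2Q_add.
Proof.
move=> f g h; rewrite -[f]tm_classK -[g]tm_classK -[h]tm_classK.
by rewrite -!tm_class_add; apply/tm_classP; exact: eqv_addA.
Qed.

Lemma A2Q_addC : commutative A2Q_add.
Proof.
move=> f g; rewrite -[f]tm_classK -[g]tm_classK.
by rewrite -!tm_class_add; apply/tm_classP; exact: eqv_addC.
Qed.

Lemma A2Q_add0 : left_id A2Q_zero A2Q_add.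
Proof.
move=> f; rewrite -[f]tm_classK -!tm_class_add.
by apply/tm_classP; exact: eqv_add0.
Qed.

Lemma A2Q_addN : left_inverse A2Q_zero A2Q_opp A2Q_add.
Proof.
move=> f; rewrite A2Q_addC -[f]tm_classK /A2Q_opp -tm_class_scale -tm_class_add.
by apply/tm_classP; exact: eqv_addN.
Qed.

HB.instance Definition _ :=
  GRing.isZmodule.Build A2Q_hom A2Q_addA A2Q_addC A2Q_add0 A2Q_addN.

Lemma A2Q_scaleA a b (f : A2Q_hom) :
  A2Q_scale a (A2Q_scale b f) = A2Q_scale (a * b) f.
Proof.
rewrite -[f]tm_classK -!tm_class_scale.
by apply/tm_classP; exact: eqv_scaleA.
Qed.

Lemma A2Q_scale1 : left_id 1 A2Q_scale.
Proof.
move=> f; rewrite -[f]tm_classK -!tm_class_scale.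
by apply/tm_classP; exact: eqv_scale1.
Qed.

Lemma A2Q_scaleDr : right_distributive A2Q_scale +%R.
Proof.
move=> a f g; rewrite -[f]tm_classK -[g]tm_classK.
rewrite -[_ + _ in LHS]tm_class_add -!tm_class_scale -[RHS]tm_class_add.
by apply/tm_classP; exact: eqv_scaleDr.
Qed.

Lemma A2Q_scaleDl f : {morph A2Q_scale^~ f : a b / a + b}.
Proof.
move=> a b; rewrite -[f]tm_classK -!tm_class_scale -[RHS]tm_class_add.
by apply/tm_classP; exact: eqv_scaleDl.
Qed.

HB.instance Definition _ := GRing.Zmodule_isLmodule.Build K A2Q_hom
  A2Q_scaleA A2Q_scale1 A2Q_scaleDr A2Q_scaleDl.

Lemma tm_classD f g : tm_class (tm_add f g) = tm_class f + tm_class g.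
Proof. exact: tm_class_add. Qed.

Lemma tm_classZ a f : tm_class (tm_scale a f) = a *: tm_class f.
Proof. exact: tm_class_scale. Qed.

(* The degree d part of the Hom space: it consists of the classes of the      *)
(* homogeneous terms of degree d.                                             *)
Definition A2Q_deg (d : int) : pred A2Q_hom :=
  fun h => `[< exists2 f, tm_homog C d f & h = tm_class f >].

Lemma A2Q_degP d h :
  reflect (exists2 f, tm_homog C d f & h = tm_class f) (h \in A2Q_deg d).
Proof. exact: asboolP. Qed.

Lemma A2Q_deg_submod d : submod_closed (A2Q_deg d).
Proof.
split => [|a f g /A2Q_degP[f' hf ->] /A2Q_degP[g' hg ->]]; apply/A2Q_degP.
  by exists (tm_zero X Y) => //; exact: homog_zero.
exists (tm_add (tm_scale a f') g'); last by rewrite tm_classD tm_classZ.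
by apply: homog_add => //; exact: homog_scale.
Qed.

HB.instance Definition _ d :=
  GRing.isSubmodClosed.Build K A2Q_hom (A2Q_deg d) (A2Q_deg_submod d).

Record A2Q_hom_deg (d : int) := A2QHomDeg {
  deg_val :> A2Q_hom;
  deg_valP : deg_val \in A2Q_deg d
}.

HB.instance Definition _ d := [isSub for @deg_val d].
HB.instance Definition _ d := [Choice of A2Q_hom_deg d by <:].
HB.instance Definition _ d := [SubChoice_isSubLmodule of A2Q_hom_deg d by <:].

End Hom.

Definition A2Q_comp X Y Z (f : A2Q_hom Y Z) (g : A2Q_hom X Y) : A2Q_hom X Z :=
  tm_class (tm_comp (repr f) (repr g)).

Lemma tm_class_comp X Y Z (f : tm K Y Z) (g : tm K X Y) :
  tm_class (tm_comp f g) = A2Q_comp (tm_class f) (tm_class g).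
Proof. by apply/tm_classP; apply: eqv_comp; apply: eqv_sym; exact: tm_repr. Qed.

Lemma A2Q_compA W X Y Z
    (f : A2Q_hom Y Z) (g : A2Q_hom X Y) (h : A2Q_hom W X) :
  A2Q_comp f (A2Q_comp g h) = A2Q_comp (A2Q_comp f g) h.
Proof.
rewrite -[f]tm_classK -[g]tm_classK -[h]tm_classK -!tm_class_comp.
by apply/tm_classP; exact: eqv_compA.
Qed.

Lemma A2Q_comp1l X Y (f : A2Q_hom X Y) : A2Q_comp (tm_class (tm_id Y)) f = f.
Proof.
rewrite -[f]tm_classK -!tm_class_comp.
by apply/tm_classP; exact: eqv_comp1l.
Qed.

Lemma A2Q_comp1r X Y (f : A2Q_hom X Y) : A2Q_comp f (tm_class (tm_id X)) = f.
Proof.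
rewrite -[f]tm_classK -!tm_class_comp.
by apply/tm_classP; exact: eqv_comp1r.
Qed.

Lemma A2Q_compl_linear X Y Z (g : A2Q_hom X Y) :
  linear (fun f : A2Q_hom Y Z => A2Q_comp f g).
Proof.
move=> a f f'; rewrite -[f]tm_classK -[f']tm_classK -[g]tm_classK.
rewrite -tm_classZ -tm_classD -!tm_class_comp -tm_classZ -tm_classD.
apply/tm_classP; apply: eqv_trans (eqv_compDl _ _ _ _) _.
by apply: eqv_add; [exact: eqv_compZl | exact: eqv_refl].
Qed.

Lemma A2Q_compr_linear X Y Z (f : A2Q_hom Y Z) :
  linear (fun g : A2Q_hom X Y => A2Q_comp f g).
Proof.
move=> a g g'; rewrite -[f]tm_classK -[g]tm_classK -[g']tm_classK.
rewrite -tm_classZ -tm_classD -!tm_class_comp -tm_classZ -tm_classD.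
apply/tm_classP; apply: eqv_trans (eqv_compDr _ _ _ _) _.
by apply: eqv_add; [exact: eqv_compZr | exact: eqv_refl].
Qed.

Definition A2Q : lincat K := LinCat
  A2Q_compA A2Q_comp1l A2Q_comp1r A2Q_compl_linear A2Q_compr_linear.

Lemma A2Q_deg_comp X Y Z d e (f : A2Q_hom Y Z) (g : A2Q_hom X Y) :
  f \in @A2Q_deg Y Z d -> g \in @A2Q_deg X Y e ->
  A2Q_comp f g \in @A2Q_deg X Z (d + e).
Proof.
move=> /A2Q_degP[f' hf ->] /A2Q_degP[g' hg ->]; apply/A2Q_degP.
exists (tm_comp f' g'); last by rewrite tm_class_comp.
exact: homog_comp.
Qed.

(* [A2CObj n X] is the formal shift q^n X.                                    *)
Record A2C_obj := A2CObj { a2c_shift : int; a2c_word : word I }.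

Definition A2C_hom (A B : A2C_obj) : lmodType K :=
  A2Q_hom_deg (a2c_word A) (a2c_word B) (a2c_shift A - a2c_shift B).

Definition A2C_id (A : A2C_obj) : A2C_hom A A.
Proof.
exists (tm_class (tm_id (a2c_word A))).
by rewrite subrr; apply/A2Q_degP; exists (tm_id _) => //; exact: homog_id.
Defined.

Definition A2C_comp (A B B' : A2C_obj) (f : A2C_hom B B') (g : A2C_hom A B) :
  A2C_hom A B'.
Proof.
exists (A2Q_comp (deg_val f) (deg_val g)).
have := A2Q_deg_comp (deg_valP f) (deg_valP g).
by rewrite [X in A2Q_deg X]addrC subrKA.
Defined.

Lemma A2C_compA (A A' B B' : A2C_obj)
    (f : A2C_hom B B') (g : A2C_hom A' B) (h : A2C_hom A A') :
  A2C_comp f (A2C_comp g h) = A2C_comp (A2C_comp f g) h.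
Proof. by apply: val_inj; exact: A2Q_compA. Qed.

Lemma A2C_comp1l A B (f : A2C_hom A B) : A2C_comp (A2C_id B) f = f.
Proof. by apply: val_inj; exact: A2Q_comp1l. Qed.

Lemma A2C_comp1r A B (f : A2C_hom A B) : A2C_comp f (A2C_id A) = f.
Proof. by apply: val_inj; exact: A2Q_comp1r. Qed.

Lemma A2C_compl_linear A B B' (g : A2C_hom A B) :
  linear (fun f : A2C_hom B B' => A2C_comp f g).
Proof. by move=> a f f'; apply: val_inj; exact: A2Q_compl_linear. Qed.

Lemma A2C_compr_linear A B B' (f : A2C_hom B B') :
  linear (fun g : A2C_hom A B => A2C_comp f g).
Proof. by move=> a g g'; apply: val_inj; exact: A2Q_compr_linear. Qed.

Definition A2C : lincat K := LinCat
  A2C_compA A2C_comp1l A2C_comp1r A2C_compl_linear A2C_compr_linear.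

End A2.

Record presheaf (K : fieldType) (A : lincat K) := Presheaf {
  ps_obj :> A -> lmodType K;
  ps_map : forall X Y : A, lc_hom X Y -> ps_obj Y -> ps_obj X;
  ps_map_linear : forall X Y (f : lc_hom X Y), linear (ps_map f);
  ps_linear : forall X Y (x : ps_obj Y),
    linear (fun f : lc_hom X Y => ps_map f x);
  ps_id : forall X (x : ps_obj X), ps_map (lc_id X) x = x;
  ps_comp : forall X Y Z (f : lc_hom Y Z) (g : lc_hom X Y) (x : ps_obj Z),
    ps_map (lc_comp f g) x = ps_map g (ps_map f x)
}.

Record psmor (K : fieldType) (A : lincat K) (F G : presheaf A) := PsMor {
  pm_fun :> forall X : A, F X -> G X;
  pm_linear : forall X, linear (@pm_fun X);
  pm_natural : forall X Y (f : lc_hom X Y) (x : F Y),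
    pm_fun (ps_map f x) = ps_map f (pm_fun x)
}.

Arguments pm_fun {K A F G} _ X _.

Section PresheafCategory.
Variables (K : fieldType) (A : lincat K).
Implicit Types F G H : presheaf A.

Lemma psmor_eq F G (f g : psmor F G) : (forall X x, f X x = g X x) -> f = g.
Proof.
case: f g => [f fl fn] [g gl gn] /= fg.
have efg : f = g by apply/functional_extensionality_dep => X; apply/funext => x.
by rewrite efg in fl fn *; rewrite (Prop_irrelevance fl gl) (Prop_irrelevance fn gn).
Qed.

Definition pm_id F : psmor F F :=
  @PsMor K A F F (fun _ x => x) (fun _ _ _ _ => erefl) (fun _ _ _ _ => erefl).

Definition pm_comp F G H (f : psmor G H) (g : psmor F G) : psmor F H.
Proof.
exists (fun X x => f X (g X x)).
- by move=> X a x y; rewrite !pm_linear.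
- by move=> X Y h x; rewrite !pm_natural.
Defined.

Definition pm_zero F G : psmor F G.
Proof.
exists (fun X _ => 0).
- by move=> X a x y; rewrite scaler0 addr0.
- move=> X Y h x.
  by have := ps_map_linear (p := G) h (-1) 0 0; rewrite scaler0 addr0 scaleN1r addNr.
Defined.

Definition pm_iso F G (f : psmor F G) : Prop :=
  exists g : psmor G F, pm_comp g f = pm_id F /\ pm_comp f g = pm_id G.

Section Families.
Variables (S : Type) (Y : S -> presheaf A).

Definition is_coproduct (P : presheaf A) (inj : forall s, psmor (Y s) P) :=
  forall (Z : presheaf A) (f : forall s, psmor (Y s) Z),
    exists! h : psmor P Z, forall s, pm_comp h (inj s) = f s.

Definition is_product (R : presheaf A) (proj : forall s, psmor R (Y s)) :=
  forall (Z : presheaf A) (f : forall s, psmor Z (Y s)),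
    exists! h : psmor Z R, forall s, pm_comp (proj s) h = f s.

Definition is_canonical_map (P R : presheaf A)
    (inj : forall s, psmor (Y s) P) (proj : forall s, psmor R (Y s))
    (c : psmor P R) :=
  (forall s, pm_comp (proj s) (pm_comp c (inj s)) = pm_id (Y s)) /\
  (forall s s', s <> s' ->
     pm_comp (proj s') (pm_comp c (inj s)) = pm_zero (Y s) (Y s')).

Definition is_biproduct (P : presheaf A) (inj : forall s, psmor (Y s) P) :=
  is_coproduct inj /\
  exists (R : presheaf A) (proj : forall s, psmor R (Y s)) (c : psmor P R),
    [/\ is_product proj, is_canonical_map inj proj c & pm_iso c].

End Families.

Definition yoneda (B : A) : presheaf A := @Presheaf K A
  (fun X => lc_hom X B)
  (fun X Y f g => lc_comp g f)
  (fun X Y f => lc_compl_linear f)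
  (fun X Y g => lc_compr_linear g)
  (fun X g => lc_comp1r g)
  (fun X Y Z f g h => lc_compA h f g).

End PresheafCategory.

Section Pre2.
Variables (K : fieldType) (I : finType) (C : sym_cartan I) (D : qdata K C).

Definition Pre2 := presheaf (A2C D).

(* The automorphism q^l of A_2(C), on objects and on morphisms.               *)
Definition A2C_qobj (l : int) (A : A2C D) : A2C D :=
  A2CObj (l + a2c_shift A) (a2c_word A).

Definition A2C_qhom (l : int) (A B : A2C D) (f : lc_hom A B) :
  lc_hom (A2C_qobj l A) (A2C_qobj l B).
Proof.
exists (deg_val f); rewrite /= opprD addrACA subrr add0r.
exact: deg_valP f.
Defined.

(* (q^l F)(X) = F(q^(-l) X)                                                   *)
Definition ps_shift (l : int) (F : Pre2) : Pre2.
Proof.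
exists (fun A => F (A2C_qobj (- l) A))
       (fun A B f => ps_map (p := F) (A2C_qhom (- l) f)).
- by move=> A B f; exact: ps_map_linear.
- move=> A B x a f g; rewrite -ps_linear; congr (ps_map _ x).
  exact: val_inj.
- move=> A x; rewrite -[RHS]ps_id; congr (ps_map _ x); exact: val_inj.
- move=> A B B' f g x; rewrite -ps_comp; congr (ps_map _ x); exact: val_inj.
Defined.

(* The summands of coprod_l q^l (F_1^{k_{1,l}} + ... + F_n^{k_{n,l}}) are the *)
(* q^l F_m, indexed by (l, m, a) with a < k_{m,l}.                            *)
Definition lf_index (n : nat) (k : 'I_n -> int -> nat) : Type :=
  {l : int & {m : 'I_n & 'I_(k m l)}}.

Definition lf_family (n : nat) (F : 'I_n -> Pre2) (k : 'I_n -> int -> nat)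
    (s : lf_index k) : Pre2 :=
  ps_shift (tag s) (F (tag (tagged s))).

Definition left_bounded (n : nat) (k : 'I_n -> int -> nat) : Prop :=
  exists l0 : int, forall l, l < l0 -> forall m, k m l = 0%N.

End Pre2.

(* Main.v *)
From HB Require Import structures.
Require Import Defs.
From mathcomp Require Import all_boot all_order all_algebra.
From mathcomp Require Import boolp zify.

(** The point is that Hom(X, Y) vanishes in degrees below a bound depending
    only on X and Y; a left-bounded locally finite family then has finitely many
    summands which are nonzero at a given object, so that coproduct and product
    agree there.

    Read from left to right, every strand of a diagram X -> Y is monotone: it
    enters at a letter E of X or F of Y and leaves at a letter E of Y or F of X.
    In particular there are no closed loops. The bound is obtained by removing
    one strand at a time. If X ends with F_i, bend this letter up along the
    adjunction. Otherwise Hom(X, Y) is spanned by diagrams in which the last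
    strand to enter (at the final E of X, or at the last F of Y) carries some
    dots, then crosses a segment of the trailing E's of Y, each at most once,
    while the remaining strands form an arbitrary diagram: the span of these
    contains the identity and is stable under postcomposition with the
    generators, by the nilHecke argument showing that
    R_(n+1) = sum_k T_k ... T_n K[x_(n+1)] R_n. Each strand thus contributes at
    most |Y| crossings, whose degrees are at least - 2 max d_i. *)

Set Implicit Arguments.
Unset Strict Implicit.
Unset Printing Implicit Defensive.

Import Order.TTheory GRing.Theory Num.Theory.
Local Open Scope ring_scope.

(** * Graded families of subspaces and modules over the quiver Hecke relations *)

(** Such families serve to state the relations with a polynomial right-hand side without its
    coefficients: a family stable under the dots is shifted by the degree of that side. *)
Definition graded_closed (K : fieldType) (H : lmodType K) (P : int -> H -> Prop) :=
  (forall d, P d 0) /\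
  (forall d a h h', P d h -> P d h' -> P d (a *: h + h')).

Section GradedClosed.
Variables (K : fieldType) (H : lmodType K) (P : int -> H -> Prop).
Hypothesis P_closed : graded_closed P.

Lemma graded_closed0 d : P d 0. Proof. exact: (proj1 P_closed). Qed.

Lemma graded_closedD d h h' : P d h -> P d h' -> P d (h + h').
Proof. by move=> Ph; rewrite -[h]scale1r; exact: (proj2 P_closed). Qed.

Lemma graded_closedZ d e h : P d h -> P d (e *: h).
Proof.
move=> Ph; rewrite -[_ *: _]addr0.
by apply: (proj2 P_closed) => //; exact: graded_closed0.
Qed.

End GradedClosed.

(* [at_ w h] means that h has target E_w; [x a k b] and [t a j k b] are the    *)
(* dot and the crossing E_a X_k E_b and E_a T_jk E_b. The relations are       *)
(* required only up to terms of the right degree, which is all that matters   *)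
(* for spanning sets.                                                         *)
Record klr_module (K : fieldType) (I : Type) (H : lmodType K)
    (dx : I -> int) (dt : I -> I -> int) (at_ : seq I -> H -> Prop)
    (x : seq I -> I -> seq I -> H -> H)
    (t : seq I -> I -> I -> seq I -> H -> H) : Prop := KlrModule {
  km_xlin a k b : linear (x a k b);
  km_tlin a j k b : linear (t a j k b);
  km_xat a k b h : at_ (a ++ k :: b) (x a k b h);
  km_tat a j k b h : at_ (a ++ k :: j :: b) (t a j k b h);
  km_xt_left a l b j k c h : x a l (b ++ k :: j :: c) (t (a ++ l :: b) j k c h)
    = t (a ++ l :: b) j k c (x a l (b ++ j :: k :: c) h);
  km_xt_right a j k b l c h : x (a ++ k :: j :: b) l c (t a j k (b ++ l :: c) h)
    = t a j k (b ++ l :: c) (x (a ++ j :: k :: b) l c h);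
  km_tt_far a j k b p q c h :
    t a j k (b ++ q :: p :: c) (t (a ++ j :: k :: b) p q c h)
    = t (a ++ k :: j :: b) p q c (t a j k (b ++ p :: q :: c) h);
  km_xt1 a j k b : exists2 e : K, e != 0 -> j = k & forall h,
    at_ (a ++ j :: k :: b) h ->
    x a k (j :: b) (t a j k b h) = t a j k b (x (rcons a j) k b h) + e *: h;
  km_xt2 a j k b : exists2 e : K, e != 0 -> j = k & forall h,
    at_ (a ++ j :: k :: b) h ->
    x (rcons a k) j b (t a j k b h) = t a j k b (x a j (k :: b) h) + e *: h;
  km_tt (P : int -> H -> Prop) a j k b : graded_closed P ->
    (forall d h, P d h -> P (d + dx j) (x a j (k :: b) h)) ->
    (forall d h, P d h -> P (d + dx k) (x (rcons a j) k b h)) ->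
    forall d h, at_ (a ++ j :: k :: b) h -> P d h ->
    P (d + dt j k + dt k j) (t a k j b (t a j k b h));
  km_braid0 a p q r b h : p <> r -> at_ (a ++ p :: q :: r :: b) h ->
    t (rcons a r) p q b (t a p r (q :: b) (t (rcons a p) q r b h))
    = t a q r (p :: b) (t (rcons a q) p r b (t a p q (r :: b) h));
  km_braid (P : int -> H -> Prop) a p q b : graded_closed P ->
    (forall d h, P d h -> P (d + dx p) (x a p (q :: p :: b) h)) ->
    (forall d h, P d h -> P (d + dx q) (x (rcons a p) q (p :: b) h)) ->
    (forall d h, P d h -> P (d + dx p) (x (rcons (rcons a p) q) p b h)) ->
    forall d h, at_ (a ++ p :: q :: p :: b) h -> P d h ->
    P (d + dt p q + dt p p + dt q p)
      (t (rcons a p) p q b (t a p p (q :: b) (t (rcons a p) q p b h))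
       - t a q p (p :: b) (t (rcons a q) p p b (t a p q (p :: b) h)))
}.

Lemma linear_at0 (K : fieldType) (H H' : lmodType K) (f : H -> H') :
  linear f -> f 0 = 0.
Proof. by move=> fl; have := fl (-1) 0 0; rewrite scaler0 addr0 scaleN1r addNr. Qed.

Lemma cat_cons_eq (T : Type) (a : seq T) k b u i v : a ++ k :: b = u ++ i :: v ->
  [\/ exists2 c, u = a ++ k :: c & b = c ++ i :: v,
      [/\ a = u, k = i & b = v] |
      exists2 c, a = u ++ i :: c & v = c ++ k :: b].
Proof.
elim: a u => [|a0 a IHa] [|u0 u] /=.
- by case=> -> ->; constructor 2.
- by case=> -> ->; constructor 1; exists u.
- by case=> <- <-; constructor 3; exists a.
case=> <- /IHa[[c -> ->]|[-> -> ->]|[c -> ->]].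
- by constructor 1; exists c.
- by constructor 2.
- by constructor 3; exists c.
Qed.

Lemma cat_eq_cat (T : Type) (x y z w : seq T) : x ++ y = z ++ w ->
  (exists2 c, z = x ++ c & y = c ++ w) \/ (exists2 c, x = z ++ c & w = c ++ y).
Proof.
elim: x z => [|x0 x IHx] [|z0 z] /=.
- by move=> ->; left; exists [::].
- by move=> ->; left; exists (z0 :: z).
- by move=> <-; right; exists (x0 :: x).
by case=> <- /IHx[[c -> ->]|[c -> ->]]; [left | right]; exists c.
Qed.

(** * The nilHecke argument: moving one strand from the right end to the left *)

Section CrossingStrand.
Variables (K : fieldType) (I : eqType) (H : lmodType K).
Variables (dx : I -> int) (dt : I -> I -> int).
Hypothesis (dtxx : forall j, dt j j = - dx j).
Variables (at_ : seq I -> H -> Prop).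
Variables (x : seq I -> I -> seq I -> H -> H).
Variables (t : seq I -> I -> I -> seq I -> H -> H).
Hypothesis km : klr_module dx dt at_ x t.

(** [B d w h] stands for a vector [h] of degree [d] with target [w] followed by [i], to be thought
    of as having a last strand that crosses no other. Dots anywhere and crossings within [w]
    preserve [B]. *)
Variables (i : I) (B : int -> seq I -> H -> Prop).
Hypothesis B_at : forall d w h, B d w h -> at_ (rcons w i) h.
Hypothesis B_x : forall d a k b h, B d (a ++ k :: b) h ->
  B (d + dx k) (a ++ k :: b) (x a k (rcons b i) h).
Hypothesis B_t : forall d a j k b h, B d (a ++ j :: k :: b) h ->
  B (d + dt j k) (a ++ k :: j :: b) (t a j k (rcons b i) h).
Hypothesis B_last : forall d w h, B d w h -> B (d + dx i) w (x w i [::] h).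

(** The letter [i] starts to the right of [u ++ v] and ends between [u] and [v]; the top crossing is
    the one with the first letter of [v]. *)
Fixpoint cross (u v : seq I) (h : H) : H :=
  if v is k :: v' then t u k i v' (cross (rcons u k) v' h) else h.

Definition cross_deg (v : seq I) : int := \sum_(k <- v) dt k i.

(* The vectors obtained from those of B, where a strand i stands at the right *)
(* end, by crossing it to the left over at most n letters.                    *)
Inductive crossed (n : nat) : int -> seq I -> H -> Prop :=
| crossed_0 d w : crossed n d w 0
| crossed_lin d w a h h' :
    crossed n d w h -> crossed n d w h' -> crossed n d w (a *: h + h')
| crossed_gen d u v h : (size v <= n)%N -> B d (u ++ v) h ->
    crossed n (d + cross_deg v) (u ++ i :: v) (cross u v h).

Lemma crossed_closed n w : graded_closed (fun d => crossed n d w).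
Proof. by split=> [d|d a h h']; [exact: crossed_0 | exact: crossed_lin]. Qed.

Lemma crossed_mono n m d w h : (n <= m)%N -> crossed n d w h -> crossed m d w h.
Proof.
move=> nm; elim=> [d' w'|d' w' a h1 h2 _ Gh1 _ Gh2|d' u v h' sv Bh].
- exact: crossed_0.
- exact: crossed_lin.
by apply: crossed_gen => //; exact: leq_trans nm.
Qed.

Lemma crossedZ n d w a h : crossed n d w h -> crossed n d w (a *: h).
Proof. exact: (graded_closedZ (crossed_closed n w)). Qed.

Lemma crossedD n d w h h' :
  crossed n d w h -> crossed n d w h' -> crossed n d w (h + h').
Proof. exact: (graded_closedD (crossed_closed n w)). Qed.

Lemma cross_at u v d h : B d (u ++ v) h -> at_ (u ++ i :: v) (cross u v h).
Proof.
case: v => [|k v] Bh /=; last exact: km_tat km _ _ _ _ _.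
by have := B_at Bh; rewrite cats0 cats1.
Qed.

Lemma cross_linear u v : linear (cross u v).
Proof.
elim: v u => [//|k v IHv] u a h h' /=.
by rewrite IHv (km_tlin km).
Qed.

Lemma crossed_map n m (d0 : int) w w' (f : H -> H) : linear f ->
  (forall d u v h, w = u ++ i :: v -> (size v <= n)%N -> B d (u ++ v) h ->
    crossed m (d + cross_deg v + d0) w' (f (cross u v h))) ->
  forall d h, crossed n d w h -> crossed m (d + d0) w' (f h).
Proof.
move=> fl fG d h Gh; elim: Gh fG => {d w h}
  [d w|d w a h h' _ IHh _ IHh'|d u v h sv Bh] fG.
- by rewrite (linear_at0 fl); exact: crossed_0.
- by rewrite fl; apply: crossed_lin; [exact: IHh | exact: IHh'].
- exact: fG.
Qed.

Lemma cross_x_left a k b v h :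
  x a k (b ++ i :: v) (cross (a ++ k :: b) v h)
  = cross (a ++ k :: b) v (x a k (rcons (b ++ v) i) h).
Proof.
elim: v b h => [|l v IHv] b h /=; first by rewrite cats0 cats1.
by rewrite (km_xt_left km) !(rcons_cat l) rcons_cons -!(cat_rcons l) IHv.
Qed.

Lemma cross_t_left a j k b v h :
  t a j k (b ++ i :: v) (cross (a ++ j :: k :: b) v h)
  = cross (a ++ k :: j :: b) v (t a j k (rcons (b ++ v) i) h).
Proof.
elim: v b h => [|l v IHv] b h /=; first by rewrite cats0 cats1.
by rewrite (km_tt_far km) !(rcons_cat l) !rcons_cons -!(cat_rcons l) IHv.
Qed.

Lemma crossed_cross n d u v h d' w : (size v <= n)%N -> B d (u ++ v) h ->
  d' = d + cross_deg v -> w = u ++ i :: v -> crossed n d' w (cross u v h).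
Proof. by move=> vn Bh -> ->; exact: crossed_gen. Qed.

Lemma cross_deg_cons k v : cross_deg (k :: v) = dt k i + cross_deg v.
Proof. by rewrite /cross_deg big_cons. Qed.

(** After at most [size b] crossings, [i] is the displayed letter [k] or lies in [b]. In the first
    case the new crossing prolongs the path of the strand by one letter; in the second it lies to
    the left of that path and sinks into [B]. *)
Lemma crossed_t_left n d a j k b h : (n <= size b)%N ->
  crossed n d (a ++ j :: k :: b) h ->
  crossed (size b).+1 (d + dt j k) (a ++ k :: j :: b) (t a j k b h).
Proof.
move=> nb; apply: crossed_map; first exact: km_tlin km _ _ _ _.
move=> {}d u v {}h auv vn.
case: (cat_cons_eq auv) => [[c -> kb]|[_ _ Ev]|[c _ Ev]].
- case: c kb => [[-> <-]|_ c [<- ->]] Bh.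
    rewrite cats1; apply: (@crossed_cross _ d a (j :: b)) => //.
    - by move: Bh; rewrite -catA.
    - by rewrite cross_deg_cons; lia.
  rewrite cross_t_left; apply: (crossed_cross (d := d + dt j k)).
  - by rewrite size_cat /=; lia.
  - by rewrite -catA /=; apply: B_t; rewrite -catA in Bh.
  - lia.
  - by rewrite -catA.
- by move: (leq_trans vn nb); rewrite -Ev /= ltnn.
- by move: (leq_trans vn nb); rewrite Ev size_cat /=; lia.
Qed.

(** Induction on the number of letters crossed. A dot to the left of [i], or on [i] when nothing is
    crossed, is absorbed by [B]. Any other dot slides below the top crossing, which is put back by
    [crossed_t_left]. The correction term loses the top crossing and occurs only between equal
    letters, where [dtxx] makes its degree match. *)
Lemma crossed_x n d a k b h : crossed n d (a ++ k :: b) h ->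
  crossed n (d + dx k) (a ++ k :: b) (x a k b h).
Proof.
elim/ltn_ind: n => n IHn in d a k b h *.
apply: crossed_map; first exact: km_xlin km _ _ _.
move=> {}d u v {}h auv vn.
case: (cat_cons_eq auv) => [[c -> ->]|[-> -> ->]|[c -> Ev]] Bh.
- rewrite cross_x_left; apply: (crossed_cross (d := d + dx k)) => //.
  - by rewrite -catA /=; apply: B_x; rewrite -catA in Bh.
  - lia.
  - by rewrite -catA.
- case: v vn {auv} Bh => [|l v] vn Bh.
    apply: (@crossed_cross _ (d + dx i) u [::]) => //; last lia.
    by rewrite cats0 in Bh *; exact: B_last.
  have [e eli xtE] := km_xt1 km u l i v.
  have Bh' : B d (rcons u l ++ v) h by rewrite cat_rcons.
  have cr : crossed (size v) (d + cross_deg v) (rcons u l ++ i :: v)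
    (cross (rcons u l) v h) by exact: crossed_gen.
  rewrite /= xtE; last by have := cross_at Bh'; rewrite cat_rcons.
  apply: (crossed_mono vn); apply: crossedD.
    rewrite cross_deg_cons (_ : _ + _ = d + cross_deg v + dx i + dt l i); last lia.
    apply: (@crossed_t_left (size v)) => //.
    by rewrite -cat_rcons; apply: IHn.
  have [->|e0] := eqVneq e 0; first by rewrite scale0r; exact: crossed_0.
  apply: crossedZ; apply: (crossed_mono (leqnSn _)).
  move: cr; rewrite (eli e0) cat_rcons cross_deg_cons dtxx.
  by rewrite (_ : d + (- dx i + cross_deg v) + dx i = d + cross_deg v) //; lia.
case: c => [|m c] in Ev *.
  rewrite Ev in vn Bh *.
  have [e eki xtE] := km_xt2 km u k i b.
  have Bh' : B d (rcons u k ++ b) h by rewrite cat_rcons.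
  have cr : crossed (size b) (d + cross_deg b) (rcons u k ++ i :: b)
    (cross (rcons u k) b h) by exact: crossed_gen.
  rewrite /= -catA /= cats1 xtE; last by have := cross_at Bh'; rewrite cat_rcons.
  apply: (crossed_mono vn); apply: crossedD.
    rewrite cross_deg_cons (_ : _ + _ = d + cross_deg b + dx k + dt k i); last lia.
    apply: (@crossed_t_left (size b)) => //.
    by apply: IHn => //; rewrite -cat_rcons.
  have [->|e0] := eqVneq e 0; first by rewrite scale0r; exact: crossed_0.
  apply: crossedZ; apply: (crossed_mono (leqnSn _)).
  move: cr; rewrite -(eki e0) cat_rcons cross_deg_cons (eki e0) dtxx.
  by rewrite (_ : d + (- dx i + cross_deg b) + dx i = d + cross_deg b) //; lia.
rewrite Ev in vn Bh *.
have Bh' : B d (rcons u m ++ (c ++ k :: b)) h by rewrite cat_rcons.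
rewrite /= (km_xt_right km) -catA /=; apply: (crossed_mono vn).
rewrite cross_deg_cons.
rewrite (_ : _ + dx k = d + cross_deg (c ++ k :: b) + dx k + dt m i); last lia.
apply: (@crossed_t_left (size (c ++ k :: b))) => //.
have -> : u ++ [:: m, i & c ++ k :: b] = (u ++ [:: m, i & c]) ++ k :: b.
  by rewrite -catA.
apply: IHn => //; rewrite -catA /= -(cat_rcons m).
exact: crossed_gen.
Qed.

(** Induction on the number of letters crossed, according to the position of [i]. At [k] or to its
    right, [crossed_t_left] applies; at [j], the quadratic relation leaves dots on a shorter path;
    immediately left of [j], the braid relation is used; further left, the new crossing commutes
    with the top one. *)
Lemma crossed_t n d a j k b h : crossed n d (a ++ j :: k :: b) h ->
  crossed (maxn n (size b).+1) (d + dt j k) (a ++ k :: j :: b) (t a j k b h).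
Proof.
elim/ltn_ind: n => n IHn in d a j k b h *.
apply: crossed_map; first exact: km_tlin km _ _ _ _.
move=> {}d u v {}h auv vn.
case: (cat_cons_eq auv) => [[c Eu kb]|[Ea Ej Ev]|[c Ea Ev]] Bh.
- apply: (crossed_mono (leq_maxr _ _)); apply: (@crossed_t_left (size v)) => //.
    by case: c kb {Eu} => [[_ ->]|_ c [_ ->]] //; rewrite size_cat /=; lia.
  by rewrite auv; exact: crossed_gen.
- rewrite -Ev in vn Bh; rewrite {}Ej {}Ea in auv *.
  apply: (crossed_mono (leq_maxr _ _)); apply: (crossed_mono (leqnSn _)).
  have Bh' : B d (rcons u k ++ b) h by rewrite cat_rcons.
  rewrite -Ev cross_deg_cons (_ : _ + dt i k = d + cross_deg b + dt k i + dt i k); last lia.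
  apply: (km_tt km (P := fun d => crossed (size b) d (u ++ k :: i :: b))).
  - exact: crossed_closed.
  - by move=> d' h'; exact: crossed_x.
  - by move=> d' h'; rewrite -cat_rcons; exact: crossed_x.
  - by rewrite -cat_rcons; exact: cross_at Bh'.
  - by rewrite -cat_rcons; exact: crossed_gen.
case: c => [|m c] in Ea Ev.
  rewrite {}Ea {}Ev in auv vn Bh *.
  apply: (crossed_mono (leq_maxl _ _)); apply: (crossed_mono vn).
  set h2 := cross (rcons (rcons u j) k) b h.
  have Bh' : B d (rcons (rcons u j) k ++ b) h by rewrite !cat_rcons.
  have at2 : at_ (u ++ j :: k :: i :: b) h2.
    by have := cross_at Bh'; rewrite !cat_rcons.
  have cr : crossed (size b) (d + cross_deg b) (u ++ j :: k :: i :: b) h2.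
    by rewrite -(cat_rcons j) -(cat_rcons k); exact: crossed_gen.
  (* The other side of the braid relation: the crossing of [j] with [k] now comes first, to the left
     of the path below it, and sinks into [B]. *)
  have rhs : crossed (size b).+2 (d + cross_deg [:: j, k & b] + dt j k)
      (u ++ [:: i, k, j & b])
      (t u k i (j :: b) (t (rcons u k) j i b (t u j k (i :: b) h2))).
    have -> : t u j k (i :: b) h2
        = cross (u ++ [:: k, j & [::]]) b (t u j k (rcons b i) h).
      have := @cross_t_left u j k [::] b h; rewrite /= => <-.
      by rewrite /h2 -!cats1 -!catA.
    have -> : u ++ [:: k; j] = rcons (rcons u k) j by rewrite -!cats1 -catA.
    apply: (@crossed_cross _ (d + dt j k) u [:: k, j & b]) => //.
    - by apply: B_t.
    - by rewrite !cross_deg_cons; lia.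
  rewrite -catA /= cats1 -[X in crossed _ _ _ X](subrK
    (t u k i (j :: b) (t (rcons u k) j i b (t u j k (i :: b) h2)))).
  apply: crossedD => //.
  (* The two sides can differ only for [j = i], and then by a polynomial in the dots applied to the
     path without its last two crossings. *)
  have [ji|/eqP ji] := eqVneq j i; last first.
    by rewrite (km_braid0 km) // subrr; exact: crossed_0.
  subst j.
  apply: (crossed_mono (leqW (leqnSn _))).
  rewrite !cross_deg_cons.
  rewrite (_ : _ + dt i k = d + cross_deg b + dt i k + dt i i + dt k i); last lia.
  apply: (km_braid km (P := fun d => crossed (size b) d (u ++ i :: k :: i :: b))) => //.
  - exact: crossed_closed.
  - by move=> d' h'; exact: crossed_x.
  - by move=> d' h'; rewrite -cat_rcons; exact: crossed_x.
  - by move=> d' h'; rewrite -(cat_rcons i u) -cat_rcons; exact: crossed_x.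
rewrite {}Ea {}Ev in auv vn Bh *.
apply: (crossed_mono (leq_maxl _ _)); apply: (crossed_mono vn).
have Bh' : B d (rcons u m ++ (c ++ j :: k :: b)) h by rewrite cat_rcons.
rewrite /= -(km_tt_far km) -catA /= cross_deg_cons.
have sc : size (c ++ [:: j, k & b]) = size (c ++ [:: k, j & b]).
  by rewrite !size_cat.
rewrite (_ : _ + dt j k = d + cross_deg (c ++ [:: j, k & b]) + dt j k + dt m i);
  last lia.
rewrite sc; apply: (@crossed_t_left (size (c ++ k :: j :: b))) => //.
have -> : u ++ [:: m, i & c ++ [:: k, j & b]] = (u ++ [:: m, i & c]) ++ [:: k, j & b].
  by rewrite -catA.
have -> : size (c ++ [:: k, j & b]) = maxn (size (c ++ [:: k, j & b])) (size b).+1.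
  by rewrite size_cat /=; lia.
apply: IHn; first by rewrite -sc.
by rewrite -catA /= -(cat_rcons m) -sc; exact: crossed_gen.
Qed.

End CrossingStrand.

(* Left-right reflection; the opposite sign that it produces in the relations *)
(* is allowed for in [klr_module].                                            *)
Lemma klr_module_rev (K : fieldType) (I : Type) (H : lmodType K) dx dt at_ x t :
  @klr_module K I H dx dt at_ x t ->
  klr_module dx dt (fun w => at_ (rev w)) (fun a k b => x (rev b) k (rev a))
    (fun a j k b => t (rev b) k j (rev a)).
Proof.
move=> km; split.
- by move=> a k b; exact: (km_xlin km).
- by move=> a j k b; exact: (km_tlin km).
- by move=> a k b h; rewrite rev_cat rev_cons cat_rcons; exact: (km_xat km).
- move=> a j k b h; rewrite rev_cat !rev_cons !cat_rcons; exact: (km_tat km).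
- move=> a l b j k c h; rewrite !(rev_cat, rev_cons, cat_rcons).
  by rewrite (km_xt_right km).
- move=> a j k b l c h; rewrite !(rev_cat, rev_cons, cat_rcons).
  by rewrite (km_xt_left km).
- move=> a j k b p q c h; rewrite !(rev_cat, rev_cons, cat_rcons).
  by rewrite -(km_tt_far km).
- move=> a j k b; have [e ejk xtE] := km_xt2 km (rev b) k j (rev a).
  exists e => [/ejk -> //|h].
  by rewrite rev_cat !rev_cons !cat_rcons rev_rcons => /xtE.
- move=> a j k b; have [e ejk xtE] := km_xt1 km (rev b) k j (rev a).
  exists e => [/ejk -> //|h].
  by rewrite rev_cat !rev_cons !cat_rcons rev_rcons => /xtE.
- move=> P a j k b Pc Px1 Px2 d h hat Ph.
  rewrite addrAC; apply: (km_tt km) => //.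
  + by move=> d' h' /Px2; rewrite rev_rcons.
  + by move=> d' h' /Px1; rewrite rev_cons.
  + by move: hat; rewrite rev_cat !rev_cons !cat_rcons.
- move=> a p q r b h pr; rewrite rev_cat !rev_cons !rev_rcons !cat_rcons => hat.
  by rewrite (km_braid0 km) //; exact: nesym.
- move=> P a p q b Pc Px1 Px2 Px3 d h hat Ph.
  rewrite !rev_cons !rev_rcons -opprB.
  set z := (X in P _ (- X)).
  suff Pz : P (d + dt p q + dt p p + dt q p) z.
    by rewrite -scaleN1r; exact: graded_closedZ.
  apply: (km_braid km) => //.
  + by move=> d' h' /Px3; rewrite !rev_rcons.
  + by move=> d' h' /Px2; rewrite rev_cons rev_rcons.
  + by move=> d' h' /Px1; rewrite !rev_cons.
  + by move: hat; rewrite rev_cat !rev_cons !cat_rcons.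
Qed.

(** Meant for an operator acting to the left of the path of the strand: it changes the prefix of the
    target, and with it [t] into [t']. *)
Lemma cross_intertwine (K : fieldType) (I : eqType) (H : lmodType K)
    (t t' : seq I -> I -> I -> seq I -> H -> H) (F : seq I -> H -> H) (i : I) :
  (forall a j k b h,
     F (a ++ k :: j :: b) (t a j k b h) = t' a j k b (F (a ++ j :: k :: b) h)) ->
  forall u v h, F (u ++ i :: v) (cross t i u v h)
    = cross t' i u v (F (rcons (u ++ v) i) h).
Proof.
move=> Ft u v h; elim: v u h => [|k v IHv] u h /=; first by rewrite cats0 cats1.
by rewrite Ft -!(cat_rcons k) IHv.
Qed.

(** * Products of families of vector spaces *)

Section DependentFunctions.
Variables (K : fieldType) (S : Type) (V : S -> lmodType K).

(** The named type carries the module structure; it serves both for morphisms to all targets at once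
    ([hvec]) and for products of presheaves ([ps_prod]). *)
Definition dfun := forall s, V s.

HB.instance Definition _ := gen_eqMixin dfun.
HB.instance Definition _ := gen_choiceMixin dfun.

Definition dfun_zero : dfun := fun=> 0.
Definition dfun_add (f g : dfun) : dfun := fun s => f s + g s.
Definition dfun_opp (f : dfun) : dfun := fun s => - f s.
Definition dfun_scale a (f : dfun) : dfun := fun s => a *: f s.

Lemma dfunP (f g : dfun) : (forall s, f s = g s) -> f = g.
Proof. exact: functional_extensionality_dep. Qed.

Lemma dfun_addA : associative dfun_add.
Proof. by move=> f g h; apply: dfunP => s; exact: addrA. Qed.
Lemma dfun_addC : commutative dfun_add.
Proof. by move=> f g; apply: dfunP => s; exact: addrC. Qed.
Lemma dfun_add0 : left_id dfun_zero dfun_add.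
Proof. by move=> f; apply: dfunP => s; exact: add0r. Qed.
Lemma dfun_addN : left_inverse dfun_zero dfun_opp dfun_add.
Proof. by move=> f; apply: dfunP => s; exact: addNr. Qed.

HB.instance Definition _ :=
  GRing.isZmodule.Build dfun dfun_addA dfun_addC dfun_add0 dfun_addN.

Lemma dfun_scaleA a b f : dfun_scale a (dfun_scale b f) = dfun_scale (a * b) f.
Proof. by apply: dfunP => s; exact: scalerA. Qed.
Lemma dfun_scale1 : left_id 1 dfun_scale.
Proof. by move=> f; apply: dfunP => s; exact: scale1r. Qed.
Lemma dfun_scaleDr : right_distributive dfun_scale +%R.
Proof. by move=> a f g; apply: dfunP => s; exact: scalerDr. Qed.
Lemma dfun_scaleDl f : {morph dfun_scale^~ f : a b / a + b}.
Proof. by move=> a b; apply: dfunP => s; exact: scalerDl. Qed.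

HB.instance Definition _ := GRing.Zmodule_isLmodule.Build K dfun
  dfun_scaleA dfun_scale1 dfun_scaleDr dfun_scaleDl.

Definition dsingle s (v : V s) : dfun := fun s' =>
  match pselect (s = s') with
  | left e => ecast z (V z) e v
  | right _ => 0
  end.

Lemma dsingleE s (v : V s) : dsingle v s = v.
Proof.
rewrite /dsingle; case: pselect => // e.
by rewrite (Prop_irrelevance e erefl).
Qed.

Lemma dsingle_neq s (v : V s) s' : s <> s' -> dsingle v s' = 0.
Proof. by rewrite /dsingle; case: pselect. Qed.

Lemma dsingle_linear s : linear (@dsingle s).
Proof.
move=> a u v; apply: dfunP => s'.
have [e|ne] := pselect (s = s').
  by case: s' / e; rewrite !dsingleE /GRing.add /= /GRing.scale /= /dfun_add
    /dfun_scale !dsingleE.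
by rewrite dsingle_neq // /GRing.add /= /dfun_add /GRing.scale /= /dfun_scale
  !dsingle_neq // scaler0 addr0.
Qed.

Lemma dfunDE (f g : dfun) s : (f + g) s = f s + g s. Proof. by []. Qed.
Lemma dfunZE a (f : dfun) s : (a *: f) s = a *: f s. Proof. by []. Qed.

End DependentFunctions.

Notation wordE := (map (@genE _)).

(** * Diagrams as operators on morphisms with a fixed source *)

Section Diagrams.
Variables (K : fieldType) (I : finType) (C : sym_cartan I) (D : qdata K C).
Implicit Types (X Y Z a b c : word I).

Local Infix "∘" := tm_comp (at level 40, left associativity).
Local Infix "⊗" := tm_tens (at level 34, right associativity).
Local Notation "f =T g" := (tm_eqv D f g) (at level 70).

(* Equality of terms up to the transports of [tm_cast].                       *)
Definition tm_heqv X Y (f : tm K X Y) X' Y' (f' : tm K X' Y') : Prop :=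
  exists (eX : X = X') (eY : Y = Y'), tm_eqv D (tm_cast eX eY f) f'.

Local Notation "f =H g" := (tm_heqv f g) (at level 70).

Lemma tm_heqvW X Y (f g : tm K X Y) : f =T g -> f =H g.
Proof. by move=> fg; exists erefl, erefl. Qed.

Lemma tm_heqv_sym X Y (f : tm K X Y) X' Y' (f' : tm K X' Y') :
  f =H f' -> f' =H f.
Proof.
by case=> eX [eY]; case: X' / eX f' => f'; case: Y' / eY f' => f' /= /eqv_sym;
  exact: tm_heqvW.
Qed.

Lemma tm_heqv_trans X Y (f : tm K X Y) X' Y' (f' : tm K X' Y')
    X'' Y'' (f'' : tm K X'' Y'') : f =H f' -> f' =H f'' -> f =H f''.
Proof.
case=> eX [eY]; case: X' / eX f' => f'; case: Y' / eY f' => f' /= ff'.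
case=> eX [eY]; case: X'' / eX f'' => f''; case: Y'' / eY f'' => f'' /= f'f''.
by apply: tm_heqvW; exact: eqv_trans f'f''.
Qed.

Lemma tm_heqv_tens X Y (f : tm K X Y) X' Y' (f' : tm K X' Y')
    Z W (g : tm K Z W) Z' W' (g' : tm K Z' W') :
  f =H f' -> g =H g' -> f ⊗ g =H f' ⊗ g'.
Proof.
case=> eX [eY]; case: X' / eX f' => f'; case: Y' / eY f' => f' /= ff'.
case=> eX [eY]; case: Z' / eX g' => g'; case: W' / eY g' => g' /= gg'.
by apply: tm_heqvW; exact: eqv_tens.
Qed.

Lemma tm_heqv_tensA X Y (f : tm K X Y) X' Y' (f' : tm K X' Y')
    Z W (g : tm K Z W) : f ⊗ (f' ⊗ g) =H (f ⊗ f') ⊗ g.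
Proof. by exists (catA _ _ _), (catA _ _ _); exact: eqv_tensA. Qed.

Lemma tm_heqv_refl X Y (f : tm K X Y) : f =H f.
Proof. by apply: tm_heqvW; exact: eqv_refl. Qed.

Variable X0 : word I.

(** A morphism from [X0] to [Y] is seen as an element supported at [Y], which is what [hat]
    expresses. *)
Definition hvec := dfun (fun Y => A2Q_hom D X0 Y : lmodType K).

Definition hsingle Y (f : tm K X0 Y) : hvec := dsingle (tm_class D f : A2Q_hom D X0 Y).

Definition hat Y (h : hvec) : Prop := forall Y', Y <> Y' -> h Y' = 0.

(* Postcomposition with [k], extended by 0 to morphisms with another target:  *)
(* such operators compose without conditions on source and target, so that no *)
(* transport along equalities of words is needed from here on.                *)
Definition post Y Z (k : tm K Y Z) (h : hvec) : hvec :=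
  dsingle (A2Q_comp (tm_class D k) (h Y) : A2Q_hom D X0 Z).

Definition layer a S T (g : tm K S T) b : hvec -> hvec :=
  post (tm_id a ⊗ (g ⊗ tm_id b)).

Lemma post_linear Y Z (k : tm K Y Z) : linear (post k).
Proof.
move=> e h h'; rewrite /post dfunDE dfunZE.
by rewrite (A2Q_compr_linear (tm_class D k)) dsingle_linear.
Qed.

Lemma post_heqv Y Z (k : tm K Y Z) Y' Z' (k' : tm K Y' Z') h :
  k =H k' -> post k h = post k' h.
Proof.
case=> eX [eY]; case: Y' / eX k' => k'; case: Z' / eY k' => k' /= /tm_classP kk'.
by rewrite /post kk'.
Qed.

Lemma post_eqv Y Z (k k' : tm K Y Z) h : k =T k' -> post k h = post k' h.
Proof. by move=> /tm_heqvW; exact: post_heqv. Qed.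

Lemma post_comp Y Z W (k : tm K Z W) (k' : tm K Y Z) h :
  post (k ∘ k') h = post k (post k' h).
Proof. by rewrite /post dsingleE tm_class_comp A2Q_compA. Qed.

Lemma hat_single Y (f : tm K X0 Y) : hat Y (hsingle f).
Proof. by move=> Y'; exact: dsingle_neq. Qed.

Lemma hat_post Y Z (k : tm K Y Z) h : hat Z (post k h).
Proof. by move=> Y'; exact: dsingle_neq. Qed.

Lemma hatE Y h : hat Y h -> h = hsingle (repr (h Y)).
Proof.
move=> hY; apply: dfunP => Y'; rewrite /hsingle tm_classK.
have [e|ne] := pselect (Y = Y'); first by case: Y' / e; rewrite dsingleE.
by rewrite dsingle_neq // hY.
Qed.

Lemma post_single Y Z (k : tm K Y Z) f : post k (hsingle f) = hsingle (k ∘ f).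
Proof. by rewrite /post /hsingle dsingleE tm_class_comp. Qed.

Lemma hsingle_eqv Y (f g : tm K X0 Y) : hsingle f = hsingle g <-> f =T g.
Proof.
split=> [fg|/tm_classP fg]; last by rewrite /hsingle fg.
by apply/tm_classP; have := congr1 (fun h : hvec => h Y) fg; rewrite /hsingle !dsingleE.
Qed.

Lemma post_id Y h : hat Y h -> post (tm_id Y) h = h.
Proof.
move=> /hatE ->; rewrite post_single; apply/hsingle_eqv; exact: eqv_comp1l.
Qed.

Lemma postD Y Z (k k' : tm K Y Z) h : post (tm_add k k') h = post k h + post k' h.
Proof.
rewrite /post tm_classD; have := A2Q_compl_linear (h Y) 1 (tm_class D k) (tm_class D k').
rewrite !scale1r => ->; have := @dsingle_linear _ _ (fun Y => A2Q_hom D X0 Y : lmodType K) Z 1.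
by move=> /(_ (A2Q_comp (tm_class D k) (h Y)) (A2Q_comp (tm_class D k') (h Y)));
  rewrite !scale1r.
Qed.

Lemma postZ Y Z e (k : tm K Y Z) h : post (tm_scale e k) h = e *: post k h.
Proof.
rewrite /post tm_classZ; have lc := A2Q_compl_linear (h Y).
have := lc Z e (tm_class D k) 0; rewrite (linear_at0 (lc _)) !addr0 => ->.
have ls := @dsingle_linear _ _ (fun Y => A2Q_hom D X0 Y : lmodType K) Z.
by have := ls e (A2Q_comp (tm_class D k) (h Y)) 0; rewrite (linear_at0 ls) !addr0.
Qed.

Section Layers.
Variables (S T : word I).
Implicit Types g : tm K S T.

Lemma layer_linear a g b : linear (layer a g b).
Proof. exact: post_linear. Qed.

Lemma hat_layer a g b h : hat (a ++ T ++ b) (layer a g b h).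
Proof. exact: hat_post. Qed.

Lemma layer_eqv a g g' b h : g =T g' -> layer a g b h = layer a g' b h.
Proof.
move=> gg'; apply: post_eqv; apply: eqv_tens; first exact: eqv_refl.
by apply: eqv_tens => //; exact: eqv_refl.
Qed.

Lemma layerD a g g' b h :
  layer a (tm_add g g') b h = layer a g b h + layer a g' b h.
Proof.
rewrite /layer -postD; apply: post_eqv.
apply: eqv_trans (eqv_tensDr _ _ _ _); apply: eqv_tens; first exact: eqv_refl.
exact: eqv_tensDl.
Qed.

Lemma layerZ a e g b h : layer a (tm_scale e g) b h = e *: layer a g b h.
Proof.
rewrite /layer -postZ; apply: post_eqv.
apply: eqv_trans (eqv_tensZr _ _ _ _); apply: eqv_tens; first exact: eqv_refl.
exact: eqv_tensZl.
Qed.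

End Layers.

Lemma layer0 S T a b h : layer a (tm_zero S T) b h = 0.
Proof.
rewrite -(scale0r (layer a (tm_zero S T) b h)) -layerZ; apply: layer_eqv.
by apply/tm_classP; rewrite tm_classZ scale0r.
Qed.

Lemma layer_id a S b h : hat (a ++ S ++ b) h -> layer a (tm_id S) b h = h.
Proof.
move=> hh; rewrite -[RHS](post_id hh); apply: post_eqv.
apply: eqv_trans (eqv_tens11 _ _ _); apply: eqv_tens; first exact: eqv_refl.
exact: eqv_tens11.
Qed.

Lemma layer_comp S T U a (g : tm K T U) (g' : tm K S T) b h :
  layer a (g ∘ g') b h = layer a g b (layer a g' b h).
Proof.
rewrite /layer -post_comp; apply: post_eqv.
apply: eqv_trans (eqv_interchange _ _ _ _ _); apply: eqv_tens.
  by apply: eqv_sym; exact: eqv_comp1l.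
apply: eqv_trans (eqv_interchange _ _ _ _ _); apply: eqv_tens.
  exact: eqv_refl.
by apply: eqv_sym; exact: eqv_comp1l.
Qed.

Lemma layer_whiskerl S T a c (g : tm K S T) b h :
  layer a (tm_id c ⊗ g) b h = layer (a ++ c) g b h.
Proof.
apply: post_heqv.
apply: tm_heqv_trans (tm_heqv_tens (tm_heqv_refl _) (tm_heqv_sym (tm_heqv_tensA _ _ _))) _.
apply: tm_heqv_trans (tm_heqv_tensA _ _ _) _.
apply: tm_heqv_tens (tm_heqv_refl _); apply: tm_heqvW; exact: eqv_tens11.
Qed.

Lemma layer_whiskerr S T a c (g : tm K S T) b h :
  layer a (g ⊗ tm_id c) b h = layer a g (c ++ b) h.
Proof.
apply: post_heqv; apply: tm_heqv_tens (tm_heqv_refl _) _.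
apply: tm_heqv_trans (tm_heqv_sym (tm_heqv_tensA _ _ _)) _.
apply: tm_heqv_tens (tm_heqv_refl _) _; apply: tm_heqvW; exact: eqv_tens11.
Qed.

(** The interchange law, after each factor is extended by identities over the word between [a] and
    [b]. *)
Lemma layer_far S T S' T' a (g : tm K S T) m (g' : tm K S' T') b h :
  layer a g (m ++ T' ++ b) (layer (a ++ S ++ m) g' b h)
  = layer (a ++ T ++ m) g' b (layer a g (m ++ S' ++ b) h).
Proof.
rewrite !catA -2!layer_whiskerl -2!layer_whiskerl -2!layer_whiskerr -!layer_comp.
apply: layer_eqv.
apply: eqv_trans (eqv_sym (eqv_interchange _ _ _ _ _)) _.
apply: eqv_trans (eqv_interchange _ _ _ _ _); apply: eqv_tens.
  by apply: eqv_trans (eqv_comp1r _ _) (eqv_sym (eqv_comp1l _ _)).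
by apply: eqv_trans (eqv_comp1l _ _) (eqv_sym (eqv_comp1r _ _)).
Qed.

Lemma layer_sum S T (P : hvec -> Prop) a n (f : 'I_n -> tm K S T) b h :
  P 0 -> (forall u v, P u -> P v -> P (u + v)) ->
  (forall i, P (layer a (f i) b h)) -> P (layer a (tm_sum f) b h).
Proof.
move=> P0 PD Pf; rewrite /tm_sum; elim/big_ind: _ => //.
  by rewrite layer0.
by move=> u v Pu Pv; rewrite layerD; exact: PD.
Qed.

End Diagrams.

(** * Degrees of the polynomials in the relations *)

Section Homogeneity.
Variables (K : fieldType) (I : finType) (C : sym_cartan I) (D : qdata K C).

Definition degX (i : I) : int := (2 * symd C i)%:Z.
Definition degT (i j : I) : int := - ((symd C i)%:Z * C i j).

Lemma degTC i j : degT i j = degT j i.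
Proof. by rewrite /degT symdC. Qed.

Lemma degTxx i : degT i i = - degX i.
Proof. by rewrite /degT /degX cartan_diag; lia. Qed.

Lemma absz_cartan i j : i != j -> `|C i j|%:Z = - C i j.
Proof. by move=> /(@cartan_offdiag _ C i j); lia. Qed.

(** Symmetrizability gives the two pure powers the same degree, and [qs_homog] gives it to the mixed
    terms. *)
Lemma Qpoly_homog i j p r : (Qpoly D i j)`_p`_r != 0 ->
  degX i * p%:Z + degX j * r%:Z = degT i j + degT j i.
Proof.
rewrite [degT j i]degTC /Qpoly /degX /degT; have [->|ij] := eqVneq i j.
  by rewrite !coef0 eqxx.
have [C0|C0] := eqVneq (C i j) 0.
  rewrite coefC; case: p => [|p] /=; last by rewrite coef0 eqxx.
  by rewrite coefC; case: r => [|r] /=; rewrite ?eqxx // C0; lia.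
have ci := absz_cartan ij; have cj := absz_cartan (contra_neq (@esym _ _ _) ij).
have sym := symdC C i j.
have ei : (symd C i * `|C i j|)%N = (symd C j * `|C j i|)%N.
  have : (symd C i)%:Z * `|C i j|%:Z = (symd C j)%:Z * `|C j i|%:Z.
    by rewrite ci cj !mulrN sym.
  by rewrite -!PoszM => -[].
move=> nz; apply/eqP; apply: contra_neqT nz => /eqP deg.
rewrite !coefD coefZ coefXn coef_sum coefC coef_sum.
rewrite big1 => [|p' _]; last first.
  rewrite !coef_sum big1 // => r' _; rewrite coefZ coefXn.
  have [pp|] := eqVneq p p'; last by rewrite mulr0 coef0.
  rewrite mulr1 coefZ coefXn; have [rr|] := eqVneq r r'; last by rewrite mulr0.
  rewrite mulr1; apply: qs_homog => // h; apply: deg; subst; lia.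
rewrite addr0; have [pC|pC] := eqVneq p `|C i j|%N.
  rewrite mulr1 coefC; case: eqP => [r0|_].
    by exfalso; apply: deg; subst; lia.
  rewrite add0r; case: eqP => [p0|_]; last by rewrite coef0.
  by exfalso; lia.
rewrite mulr0 coef0 add0r; case: eqP => [p0|_]; last by rewrite coef0.
rewrite coefZ coefXn; case: eqP => [rC|_]; last by rewrite mulr0.
by exfalso; apply: deg; subst; lia.
Qed.

(** Dividing u^p - w^p by u - w gives the sum of all u^a w^b with a + b = p - 1, so only p = a + b +
    1 contributes to a given monomial. *)
Lemma coef_ddiff (q : {poly {poly K}}) a b c : (ddiff q)`_a`_b`_c = q`_(a + b).+1`_c.
Proof.
have coefp p : ((q`_p)%:P%:P * \sum_(a' < p) 'X%:P ^+ (p.-1 - a') * 'X^a')`_a`_b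
    = q`_p * (p == (a + b).+1)%:R :> {poly K}.
  rewrite coefCM coefCM coef_sum; congr (_ * _).
  have [ap|pa] := ltnP a p.
    rewrite (bigD1 (Ordinal ap)) //= big1 => [|a' aa'].
      rewrite addr0 -polyC_exp coefCM !coefXn eqxx mulr1 coefXn.
      by congr (_%:R : {poly K}); lia.
    rewrite -polyC_exp coefCM coefXn; case: eqP => [e|_]; last by rewrite mulr0.
    by case/eqP: aa'; apply: val_inj.
  rewrite big1 => [|a' _]; last first.
    rewrite -polyC_exp coefCM coefXn; case: eqP => [e|_]; last by rewrite mulr0.
    by have := ltn_ord a'; lia.
  by rewrite coef0; case: eqP => // e; lia.
rewrite /ddiff 2!coef_sum; under eq_bigr do rewrite coefp.
have [lt|ge] := ltnP (a + b).+1 (size q); last first.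
  rewrite [q`__]nth_default // coef0 big1 ?coef0 // => p _.
  by case: eqP => [e|_]; [have := ltn_ord p; lia | rewrite mulr0].
rewrite (bigD1 (Ordinal lt)) //= eqxx mulr1 big1 ?addr0 // => p np.
case: eqP => [e|_]; last by rewrite mulr0.
by case/eqP: np; apply: val_inj.
Qed.

End Homogeneity.

(** * Action of polynomials in the dots on graded families *)

Section PolynomialLayers.
Variables (K : fieldType) (I : finType) (C : sym_cartan I) (D : qdata K C).
Variables (X0 : word I) (P : int -> hvec D X0 -> Prop).
Hypothesis P_closed : graded_closed P.
Variables (a S b : word I).

Definition raises_degree (du : int) (u : tm K S S) :=
  forall d h, P d h -> P (d + du) (layer a u b h).

Lemma layer_pow d u n : raises_degree d u ->
  forall e h, hat (a ++ S ++ b) h -> P e h ->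
  P (e + d * n%:Z) (layer a (tm_pow u n) b h).
Proof.
move=> Pu e h hh Ph; elim: n => [|n IHn] /=; first by rewrite layer_id // mulr0 addr0.
by rewrite layer_comp (_ : e + _ = e + d * n%:Z + d); [exact: Pu | lia].
Qed.

Lemma layer_eval2 du dv u v (q : {poly {poly K}}) : raises_degree du u -> raises_degree dv v ->
  forall e : int, (forall p r, q`_p`_r != 0 -> du * p%:Z + dv * r%:Z = e) ->
  forall d h, hat (a ++ S ++ b) h -> P d h ->
  P (d + e) (layer a (tm_eval2 q u v) b h).
Proof.
move=> Pu Pv e qe d h hh Ph.
apply: (layer_sum (P := P (d + e))) => [|h1 h2|p];
  [exact: graded_closed0 | exact: graded_closedD |].
apply: (layer_sum (P := P (d + e))) => [|h1 h2|r];
  [exact: graded_closed0 | exact: graded_closedD |].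
rewrite layerZ; have [->|/qe <-] := eqVneq q`_p`_r 0.
  by rewrite scale0r; exact: graded_closed0.
apply: graded_closedZ => //; rewrite layer_comp addrC -addrA addrC [_ + d]addrC.
apply: layer_pow => //; first exact: hat_layer.
exact: layer_pow.
Qed.

Lemma layer_eval3 du dw dv u w v (q : {poly {poly {poly K}}}) :
  raises_degree du u -> raises_degree dw w -> raises_degree dv v ->
  forall e : int,
    (forall p s r, q`_p`_s`_r != 0 -> du * p%:Z + dw * s%:Z + dv * r%:Z = e) ->
  forall d h, hat (a ++ S ++ b) h -> P d h ->
  P (d + e) (layer a (tm_eval3 q u w v) b h).
Proof.
move=> Pu Pw Pv e qe d h hh Ph.
apply: (layer_sum (P := P (d + e))) => [|h1 h2|p];
  [exact: graded_closed0 | exact: graded_closedD |].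
apply: (layer_sum (P := P (d + e))) => [|h1 h2|s];
  [exact: graded_closed0 | exact: graded_closedD |].
apply: (layer_sum (P := P (d + e))) => [|h1 h2|r];
  [exact: graded_closed0 | exact: graded_closedD |].
rewrite layerZ; have [->|/qe <-] := eqVneq q`_p`_s`_r 0.
  by rewrite scale0r; exact: graded_closed0.
apply: graded_closedZ => //; rewrite !layer_comp.
rewrite (_ : d + _ = d + dv * r%:Z + dw * s%:Z + du * p%:Z); last lia.
apply: layer_pow => //; first exact: hat_layer.
apply: layer_pow => //; first exact: hat_layer.
exact: layer_pow.
Qed.

End PolynomialLayers.

(** * The quiver Hecke relations on the trailing letters E *)

Section KlrModule.
Variables (K : fieldType) (I : finType) (C : sym_cartan I) (D : qdata K C).
Variables (X0 A : word I).

(** [A] is the left part of the target, which stays fixed while dots and crossings act on the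
    letters E after it. *)
Definition xlayer a k b : hvec D X0 -> hvec D X0 :=
  layer (A ++ wordE a) (tm_X k) (wordE b).
Definition tlayer a j k b : hvec D X0 -> hvec D X0 :=
  layer (A ++ wordE a) (tm_T j k) (wordE b).
Definition hat_wordE w (h : hvec D X0) : Prop := hat (A ++ wordE w) h.

Lemma layer_sub_eq S T (f g r : tm K S T) a b (h : hvec D X0) :
  tm_eqv D (tm_add f (tm_scale (-1) g)) r ->
  layer a f b h = layer a g b h + layer a r b h.
Proof.
move=> fgr; rewrite -(layer_eqv a b h fgr) layerD layerZ scaleN1r addrC.
by rewrite subrK.
Qed.

Lemma layer_braid a i j k b (h : hvec D X0) :
  (layer a (tm_comp (tm_comp (tm_tens (tm_T j k) (tm_id [:: genE i]))
     (tm_tens (tm_id [:: genE j]) (tm_T i k)))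
     (tm_tens (tm_T i j) (tm_id [:: genE k]))) b h
   = layer a (tm_T j k) (genE i :: b) (layer (a ++ [:: genE j]) (tm_T i k) b
       (layer a (tm_T i j) (genE k :: b) h)))
  * (layer a (tm_comp (tm_comp (tm_tens (tm_id [:: genE k]) (tm_T i j))
     (tm_tens (tm_T i k) (tm_id [:: genE j])))
     (tm_tens (tm_id [:: genE i]) (tm_T j k))) b h
   = layer (a ++ [:: genE k]) (tm_T i j) b (layer a (tm_T i k) (genE j :: b)
       (layer (a ++ [:: genE i]) (tm_T j k) b h))).
Proof.
split; rewrite !layer_comp.
  by rewrite (layer_whiskerr _ [:: genE i] (tm_T j k))
    (layer_whiskerl _ [:: genE j] (tm_T i k))
    (layer_whiskerr _ [:: genE k] (tm_T i j)).
by rewrite (layer_whiskerl _ [:: genE k] (tm_T i j))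
  (layer_whiskerr _ [:: genE j] (tm_T i k))
  (layer_whiskerl _ [:: genE i] (tm_T j k)).
Qed.

Lemma hvec_klr : klr_module (degX C) (degT C) hat_wordE xlayer tlayer.
Proof.
split.
- by move=> a k b; exact: layer_linear.
- by move=> a j k b; exact: layer_linear.
- move=> a k b h; rewrite /hat_wordE map_cat catA.
  exact: (@hat_layer _ _ _ _ _ _ _ (A ++ wordE a) (tm_X k) (wordE b)).
- move=> a j k b h; rewrite /hat_wordE map_cat catA.
  exact: (@hat_layer _ _ _ _ _ _ _ (A ++ wordE a) (tm_T j k) (wordE b)).
- move=> a l b j k c h; rewrite /xlayer /tlayer.
  have := layer_far (A ++ wordE a) (tm_X l) (wordE b) (tm_T j k) (wordE c) h.
  by rewrite !map_cat /= -!catA.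
- move=> a j k b l c h; rewrite /xlayer /tlayer.
  have := layer_far (A ++ wordE a) (tm_T j k) (wordE b) (tm_X l) (wordE c) h.
  by rewrite !map_cat /= -!catA => ->.
- move=> a j k b p q c h; rewrite /tlayer.
  have := layer_far (A ++ wordE a) (tm_T j k) (wordE b) (tm_T p q) (wordE c) h.
  by rewrite !map_cat /= -!catA.
- move=> a j k b; exists (if j == k then 1 else 0).
    by case: (eqVneq j k) => // _; rewrite eqxx.
  move=> h hh; rewrite /xlayer /tlayer map_rcons -cats1 catA /=.
  rewrite -(layer_whiskerr _ [:: genE j]) -(layer_whiskerl _ [:: genE j]) -!layer_comp.
  have [jk|jk] := eqVneq j k.
    subst k; rewrite (layer_sub_eq _ _ _ (rel_TXr_diag D j)) scale1r.
    rewrite (layer_whiskerl _ [:: genE j] (tm_id [:: genE j])) layer_id //.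
    by move: hh; rewrite /hat_wordE map_cat /= -!catA.
  by rewrite (layer_sub_eq _ _ _ (rel_TXr D jk)) layer0 scale0r.
- move=> a j k b; exists (if j == k then -1 else 0).
    by case: (eqVneq j k) => // _; rewrite eqxx.
  move=> h hh; rewrite /xlayer /tlayer map_rcons -cats1 catA /=.
  rewrite -(layer_whiskerr _ [:: genE k]) -(layer_whiskerl _ [:: genE k]) -!layer_comp.
  have [jk|jk] := eqVneq j k.
    subst k; rewrite (layer_sub_eq _ _ _ (rel_TXl_diag D j)) scaleN1r.
    rewrite (layer_whiskerl _ [:: genE j] (tm_id [:: genE j])) layer_id ?addrK //.
    by move: hh; rewrite /hat_wordE map_cat /= -!catA.
  by rewrite (layer_sub_eq _ _ _ (rel_TXl D jk)) layer0 scale0r !addr0.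
- move=> P a j k b Pc Px1 Px2 d h hh Ph; rewrite /tlayer -layer_comp.
  rewrite (layer_eqv _ _ _ (rel_TT D k j)) -addrA.
  (* In [Qpoly D k j] the outer variable is the dot on the right strand [k], the inner one the dot
     on the left strand [j]. *)
  apply: (layer_eval2 Pc (du := degX C k) (dv := degX C j)) => //.
  + move=> d' h' /Px2; rewrite /xlayer (layer_whiskerl _ [:: genE j] (tm_X k)).
    rewrite map_rcons -cats1.
    by rewrite -!catA.
  + by move=> d' h' /Px1; rewrite /xlayer (layer_whiskerr _ [:: genE k] (tm_X j)).
  + by move=> p r /Qpoly_homog ->; rewrite addrC.
  + by move: hh; rewrite /hat_wordE map_cat -!catA.
- move=> a p q r b h /eqP pr hh; rewrite /tlayer !map_rcons -!cats1 !catA.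
  have := layer_sub_eq (A ++ wordE a) (wordE b) h (rel_braid D q pr).
  by rewrite layer0 addr0 !layer_braid => ->.
- move=> P a p q b Pc Px1 Px2 Px3 d h hh Ph.
  rewrite /tlayer !map_rcons -!cats1 !catA.
  have := layer_sub_eq (A ++ wordE a) (wordE b) h (rel_braid_diag D p q).
  rewrite !layer_braid /= => ->; rewrite opprD addrA subrr add0r -scaleN1r.
  set z := layer _ (tm_eval3 _ _ _ _) _ _.
  suff Pz : P (d + degT C p q + degT C p p + degT C q p) z by exact: graded_closedZ.
  rewrite (_ : _ + degT C q p = d + (degT C p q + degT C p p + degT C q p)); last lia.
  apply: (layer_eval3 Pc (du := degX C p) (dw := degX C p) (dv := degX C q)) => //.
  + move=> d' h' /Px1; rewrite /xlayer.
    rewrite -(layer_whiskerr _ [:: genE q; genE p] (tm_X p)).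
    rewrite (layer_eqv _ _ _ (_ : tm_eqv D _
      (tm_tens (tm_X p) (tm_tens (tm_id [:: genE q]) (tm_id [:: genE p]))))) //.
    by apply: eqv_tens; [exact: eqv_refl | apply: eqv_sym; exact: eqv_tens11].
  + move=> d' h' /Px3; rewrite /xlayer !map_rcons -!cats1 !catA.
    rewrite (layer_whiskerl _ [:: genE p] (tm_tens (tm_id [:: genE q]) (tm_X p))).
    by rewrite (layer_whiskerl _ [:: genE q] (tm_X p)).
  + move=> d' h' /Px2; rewrite /xlayer !map_rcons -!cats1 !catA.
    rewrite (layer_whiskerl _ [:: genE p] (tm_tens (tm_X q) (tm_id [:: genE p]))).
    by rewrite (layer_whiskerr _ [:: genE p] (tm_X q)).
  (* The divided difference has one dot on the strands [p] less than [Qpoly]; this accounts for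
     [degT p p], which is minus the degree of a dot. *)
  + move=> a' b' c'; rewrite coef_ddiff => /Qpoly_homog; rewrite degTxx; lia.
  + by move: hh; rewrite /hat_wordE map_cat -!catA.
Qed.

End KlrModule.

(** * Positions of subwords relative to the trailing letters E *)

Section WordSplitting.
Variable I : Type.
Implicit Types (a b c S A Y : word I) (w s : seq I).

Lemma wordE_cat_inv w a b : wordE w = a ++ b ->
  exists w1 w2, [/\ w = w1 ++ w2, a = wordE w1 & b = wordE w2].
Proof.
move=> e; exists (take (size a) w), (drop (size a) w).
by rewrite cat_take_drop map_take map_drop e take_size_cat // drop_size_cat.
Qed.

Lemma wordE_inj : injective (fun w : seq I => wordE w).
Proof. by apply: inj_map => x y []. Qed.

Definition endsE A : Prop := exists A' k, A = A' ++ [:: genE k].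

Lemma not_endsE_F A j : ~ endsE (A ++ [:: genF j]).
Proof. by case=> A' [k]; rewrite !cats1 => /rcons_inj[]. Qed.

Lemma word_trailing A : exists A' s, A = A' ++ wordE s /\ ~ endsE A'.
Proof.
elim/last_ind: A => [|A g [A' [s [-> nE]]]].
  by exists [::], [::]; split=> // -[[|? ?] [? ?]].
case: g => k; first by exists A', (rcons s k); rewrite map_rcons rcons_cat.
exists (rcons (A' ++ wordE s) (genF k)), [::]; rewrite cats0; split=> //.
by rewrite -cats1; exact: not_endsE_F.
Qed.

(** As [A] does not end with a letter E, the block [s] cannot straddle the end of [A]. *)
Lemma split_trailing A w a s b : ~ endsE A -> a ++ wordE s ++ b = A ++ wordE w ->
  (exists2 c, A = a ++ wordE s ++ c & b = c ++ wordE w) \/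
  (exists w1 w2, [/\ a = A ++ wordE w1, b = wordE w2 & w = w1 ++ s ++ w2]).
Proof.
move=> nE /cat_eq_cat[[c Ac /cat_eq_cat[[c' cc ->]|[c' /wordE_cat_inv]]]|].
- by left; exists c'; rewrite ?Ac ?cc.
- move=> [s1 [s2 [-> Ec ->]]] /wordE_cat_inv[w1 [w2 [-> /wordE_inj <- ->]]].
  case/lastP: s1 => [|s1 k] in Ec *.
    right; exists [::], w2; split=> //.
    by rewrite Ac Ec !cats0.
  case: nE; exists (a ++ wordE s1), k.
  by rewrite Ac Ec map_rcons -cats1 catA.
case=> c -> /wordE_cat_inv[w1 [w2 [-> -> /esym/wordE_cat_inv]]].
case=> s1 [w3 [-> /wordE_inj -> ->]].
by right; exists w1, w3.
Qed.

(** The letter [genF i] cannot be one of the trailing letters E, so the pair ends within [A]. *)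
Lemma split_EF A w a i b : a ++ [:: genE i; genF i] ++ b = A ++ wordE w ->
  exists2 c, A = a ++ [:: genE i; genF i] ++ c & b = c ++ wordE w.
Proof.
rewrite catA => /cat_eq_cat[[c -> ->]|[c Ea /wordE_cat_inv[w1 [w2 [-> Ec ->]]]]].
  by exists c; rewrite // -catA.
case/lastP: w1 => [|w1 k] in Ec *.
  by exists [::] => //; rewrite cats0; move: Ea; rewrite Ec /= cats0.
move: Ea; rewrite Ec map_rcons -rcons_cat -[[:: _; _]]/([:: _] ++ [:: _]) catA cats1.
by move=> /rcons_inj[].
Qed.

End WordSplitting.

(** * The spanning set and its stability under the generators *)

Section SpanningSet.
Variables (K : fieldType) (I : finType) (C : sym_cartan I) (D : qdata K C).
Variable X0 : word I.
Local Notation hv := (hvec D X0).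
(** The base of the spanning set, for two kinds of source: [B0] will hold the identity of the empty
    word, [B1] the diagrams from a source ending with [genE]; in each application the other one is
    empty. *)
Variables (B0 : int -> hv -> Prop) (B1 : I -> int -> word I -> hv -> Prop).
Hypothesis B0_at : forall d h, B0 d h -> hat [::] h.
Hypothesis B1_at : forall i d Y h, B1 i d Y h -> hat (Y ++ [:: genE i]) h.
Hypothesis B1_layer : forall i S T (g : tm K S T) e a b d h, tm_homog C e g ->
  B1 i d (a ++ S ++ b) h ->
  B1 i (d + e) (a ++ T ++ b) (layer a g (b ++ [:: genE i]) h).
Hypothesis B1_last : forall i d Y h, B1 i d Y h ->
  B1 i (d + degX C i) Y (layer Y (tm_X i) [::] h).

(** Words are read from right to left here, so that [cross] moves a strand from left to right, as is
    done for a strand entering at a letter F. *)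
Definition trlayer (A : word I) (a : seq I) j k (b : seq I) : hv -> hv :=
  tlayer A (rev b) k j (rev a).

Lemma hvec_klr_rev A : klr_module (degX C) (degT C)
  (fun w => @hat_wordE K I C D X0 A (rev w))
  (fun a k b => xlayer A (rev b) k (rev a)) (trlayer A).
Proof. exact: klr_module_rev (hvec_klr D X0 A). Qed.

Definition cup A j r (W : word I) (g : hv) : hv :=
  iter r (layer (A ++ [:: genF j]) (tm_X j) W) (layer A (tm_eta j) W g).

(* B1 stands for the diagrams whose last strand goes straight up from a final *)
(* letter genE of X0. In [span_strand] this strand then crosses v; in         *)
(* [span_cup] the last strand to enter does so at genF j, carries r dots and  *)
(* crosses v from left to right. In [span_cup] the trailing letters genE are *)
(* listed from right to left.                                                 *)
Inductive span : int -> word I -> hv -> Prop :=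
| span_0 d Y : span d Y 0
| span_lin d Y a h h' : span d Y h -> span d Y h' -> span d Y (a *: h + h')
| span_base d h : B0 d h -> span d [::] h
| span_strand A i u v d h : B1 i d (A ++ wordE (u ++ v)) h ->
    span (d + cross_deg (degT C) i v) (A ++ wordE (u ++ i :: v))
      (cross (tlayer A) i u v h)
| span_cup A j u v r d g : span d (A ++ wordE (rev (u ++ v))) g ->
    span (d + degX C j * r%:Z + cross_deg (degT C) j v)
      ((A ++ [:: genF j]) ++ wordE (rev (u ++ j :: v)))
      (cross (trlayer (A ++ [:: genF j])) j u v
        (cup A j r (wordE (rev (u ++ v))) g)).

Lemma spanZ d Y a h : span d Y h -> span d Y (a *: h).
Proof. by move=> sh; rewrite -[_ *: _]addr0; apply: span_lin => //; exact: span_0. Qed.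

Lemma hat0 Y : hat Y (0 : hv). Proof. by []. Qed.

Lemma hat_lin Y a (h h' : hv) : hat Y h -> hat Y h' -> hat Y (a *: h + h').
Proof. by move=> hh hh' Y' ne; rewrite dfunDE dfunZE hh // hh' // scaler0 addr0. Qed.

Lemma hat_cup A j r W g : hat ((A ++ [:: genF j]) ++ genE j :: W) (cup A j r W g).
Proof.
case: r => [|r]; rewrite /cup /=.
  by have := hat_layer (a := A) (tm_eta j) (b := W) g; rewrite -catA.
exact: (hat_layer (a := A ++ [:: genF j]) (tm_X j) (b := W)).
Qed.

Definition strandB A i d w (h : hv) := B1 i d (A ++ wordE w) h.

Lemma strandB_at A i d w h : strandB A i d w h -> hat_wordE A (rcons w i) h.
Proof. by move/B1_at; rewrite /hat_wordE map_rcons -cats1 catA. Qed.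

Lemma strandB_x A i d a k b h : strandB A i d (a ++ k :: b) h ->
  strandB A i (d + degX C k) (a ++ k :: b) (xlayer A a k (rcons b i) h).
Proof.
rewrite /strandB /xlayer map_cat map_rcons -cats1 catA.
exact: (B1_layer (a := A ++ wordE a) (b := wordE b) (homog_X K C k)).
Qed.

Lemma strandB_t A i d a j k b h : strandB A i d (a ++ j :: k :: b) h ->
  strandB A i (d + degT C j k) (a ++ k :: j :: b) (tlayer A a j k (rcons b i) h).
Proof.
rewrite /strandB /tlayer !map_cat map_rcons -cats1 !catA.
exact: (B1_layer (a := A ++ wordE a) (b := wordE b) (homog_T K C j k)).
Qed.

Lemma strandB_last A i d w h : strandB A i d w h ->
  strandB A i (d + degX C i) w (xlayer A w i [::] h).
Proof. exact: B1_last. Qed.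

Lemma crossed_strand A i n d w h :
  crossed (degT C) (tlayer A) i (strandB A i) n d w h -> span d (A ++ wordE w) h.
Proof.
elim=> [d' w'|d' w' a h1 h2 _ s1 _ s2|d' u v h' _ Bh].
- exact: span_0.
- exact: span_lin.
- exact: span_strand.
Qed.

(** In [span_strand] the prefix may end with letters E; this counts them among the trailing
    letters. *)
Lemma tlayer_shift A s i u v (h : hv) :
  cross (tlayer (A ++ wordE s)) i u v h = cross (tlayer A) i (s ++ u) v h.
Proof.
elim: v u h => [//|k v IHv] u h /=.
by rewrite IHv rcons_cat /tlayer map_cat catA.
Qed.

Lemma span_hat d Y h : span d Y h -> hat Y h.
Proof.
elim=> {d Y h} [d Y|d Y a h h' _ hh _ hh'|d h /B0_at //|A i u v d h Bh|
  A j u v r d g _ _].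
- exact: hat0.
- exact: hat_lin.
- exact: (cross_at (hvec_klr D X0 A) (@strandB_at A i) Bh).
- pose B (d : int) w (h : hv) := hat ((A ++ [:: genF j]) ++ wordE (rev (rcons w j))) h.
  apply: (cross_at (hvec_klr_rev (A ++ [:: genF j])) (B := B) _ (d := 0)) => //.
  by rewrite /B rev_rcons; exact: hat_cup.
Qed.

(** Plays the part of [B] for a strand entering at [genF j]. The other strands form an arbitrary
    element of [span], whence the induction set up in [span_egen_below]. *)
Inductive cupB A j : int -> seq I -> hv -> Prop :=
| cupB_cup d w r g : span d (A ++ wordE (rev w)) g ->
    cupB A j (d + degX C j * r%:Z) w (cup A j r (wordE (rev w)) g).

Lemma crossed_cup A j n d w h :
  crossed (degT C) (trlayer (A ++ [:: genF j])) j (cupB A j) n d w h ->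
  span d ((A ++ [:: genF j]) ++ wordE (rev w)) h.
Proof.
elim=> [d' w'|d' w' a h1 h2 _ s1 _ s2|d' u v h' _ Bh].
- exact: span_0.
- exact: span_lin.
move En : (u ++ v) Bh => w0 Bh; case: Bh En => {d' w0 h'} d' w0 r g sg E.
by subst w0; exact: span_cup.
Qed.

(** Recording source and target as sequences of labels lets dots and crossings be treated together,
    also for reversed words. *)
Inductive egen : forall s s' : seq I, tm K (wordE s) (wordE s') -> int -> Prop :=
| egen_X k : @egen [:: k] [:: k] (tm_X k) (degX C k)
| egen_T j k : @egen [:: j; k] [:: k; j] (tm_T j k) (degT C j k).

Lemma egen_homog s s' (g : tm K (wordE s) (wordE s')) e : egen g e -> tm_homog C e g.
Proof. by case=> *; [exact: homog_X | exact: homog_T]. Qed.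

Lemma cup_right A j r p S T (g : tm K S T) q (h : hv) :
  layer ((A ++ [:: genF j]) ++ genE j :: p) g q (cup A j r (p ++ S ++ q) h)
  = cup A j r (p ++ T ++ q) (layer (A ++ p) g q h).
Proof.
rewrite /cup; elim: r => [|r IHr] /=.
  have := layer_far A (tm_eta j) p g q h; by rewrite -!catA /= => ->.
by rewrite -IHr; have := layer_far (A ++ [:: genF j]) (tm_X j) p g q
  (iter r (layer (A ++ [:: genF j]) (tm_X j) (p ++ S ++ q))
     (layer A (tm_eta j) (p ++ S ++ q) h)); rewrite /= => ->.
Qed.

Lemma cup_left a S T (g : tm K S T) c j r W (h : hv) :
  layer a g ((c ++ [:: genF j]) ++ genE j :: W) (cup (a ++ S ++ c) j r W h)
  = cup (a ++ T ++ c) j r W (layer a g (c ++ W) h).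
Proof.
rewrite -catA /= /cup; elim: r => [|r IHr] /=.
  by have := layer_far a g c (tm_eta j) W h; rewrite /= => ->.
have := layer_far a g (c ++ [:: genF j]) (tm_X j) W
  (iter r (layer ((a ++ S ++ c) ++ [:: genF j]) (tm_X j) W)
     (layer (a ++ S ++ c) (tm_eta j) W h)).
by move: IHr; rewrite -?catA /= => IHr; rewrite -?catA /= => ->; rewrite IHr.
Qed.

Lemma cross_left a S T (g : tm K S T) c i u v (h : hv) :
  layer a g (c ++ wordE (u ++ i :: v)) (cross (tlayer (a ++ S ++ c)) i u v h)
  = cross (tlayer (a ++ T ++ c)) i u v
      (layer a g (c ++ wordE (u ++ v) ++ [:: genE i]) h).
Proof.
rewrite (cross_intertwine (t := tlayer (a ++ S ++ c)) (t' := tlayer (a ++ T ++ c))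
  (F := fun w => layer a g (c ++ wordE w))).
  by rewrite map_rcons -cats1.
move=> a' j k b' h'; rewrite /tlayer.
have := layer_far a g (c ++ wordE a') (tm_T j k) (wordE b') h'.
by rewrite !map_cat -!catA.
Qed.

Lemma crossr_left a S T (g : tm K S T) c i u v (h : hv) :
  layer a g (c ++ wordE (rev (u ++ i :: v)))
    (cross (trlayer (a ++ S ++ c)) i u v h)
  = cross (trlayer (a ++ T ++ c)) i u v
      (layer a g (c ++ genE i :: wordE (rev (u ++ v))) h).
Proof.
rewrite (cross_intertwine (t := trlayer (a ++ S ++ c)) (t' := trlayer (a ++ T ++ c))
  (F := fun w => layer a g (c ++ wordE (rev w)))).
  by rewrite rev_rcons.
move=> a' j k b' h'; rewrite /trlayer /tlayer.
have := layer_far a g (c ++ wordE (rev b')) (tm_T k j) (wordE (rev a')) h'.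
by rewrite !rev_cat !rev_cons !cat_rcons !map_cat -!catA /=.
Qed.

Lemma span_eq d Y h d' Y' : span d Y h -> d = d' -> Y = Y' -> span d' Y' h.
Proof. by move=> sh <- <-. Qed.

Definition isF (x : gen I) := if x is genF _ then true else false.

(** The induction parameter counts letters F: taking away a strand that enters at a letter F of the
    target leaves a target with one such letter less. *)
Definition span_egen_below n := forall s s' (g : tm K (wordE s) (wordE s')) e a b d h,
  egen g e -> (count isF (a ++ b) < n)%N -> span d (a ++ wordE s ++ b) h ->
  span (d + e) (a ++ wordE s' ++ b) (layer a g b h).

Lemma count_wordE w : count isF (wordE w) = 0%N.
Proof. by elim: w. Qed.

Section CupB.
Variables (A : word I) (j : I).
Hypothesis IH : span_egen_below (count isF A).+1.
Let AF := A ++ [:: genF j].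

Lemma cupB_at d w h : cupB A j d w h -> hat_wordE AF (rev (rcons w j)) h.
Proof.
by case=> d' w' r g sg; rewrite rev_rcons; exact: hat_cup.
Qed.

(** A generator to the right of the new strand passes below the cup and acts on the remaining
    strands, where [IH] applies. *)
Lemma cupB_egen s s' (g : tm K (wordE s) (wordE s')) e d a b h : egen g e ->
  cupB A j d (a ++ rev s ++ b) h ->
  cupB A j (d + e) (a ++ rev s' ++ b)
    (layer (AF ++ wordE (rev (rcons b j))) g (wordE (rev a)) h).
Proof.
move=> eg; move En : (a ++ _) => w Bh.
case: Bh En => {d w h} d w r h sh E.
rewrite -{}E !rev_cat revK -catA !map_cat rev_rcons in sh *.
rewrite cup_right (_ : d + _ + e = d + e + degX C j * r%:Z); last lia.
have -> : wordE (rev b) ++ wordE s' ++ wordE (rev a) = wordE (rev (a ++ rev s' ++ b)).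
  by rewrite !rev_cat revK !map_cat catA.
apply: cupB_cup; rewrite !rev_cat revK -catA !map_cat catA.
apply: IH => //; last by rewrite -catA.
by rewrite !count_cat !count_wordE; lia.
Qed.

Lemma cupB_last d w h : cupB A j d w h ->
  cupB A j (d + degX C j) w (xlayer AF (rev [::]) j (rev w) h).
Proof.
rewrite /xlayer cats0; case=> d' w' r g sg.
by rewrite (_ : _ + degX C j = d' + degX C j * r.+1%:Z); [exact: cupB_cup | lia].
Qed.

Lemma crossed_cup_egen s s' (g : tm K (wordE s) (wordE s')) e n d w1 w2 h :
  egen g e ->
  crossed (degT C) (trlayer AF) j (cupB A j) n d (rev (w1 ++ s ++ w2)) h ->
  span (d + e) (AF ++ wordE (w1 ++ s' ++ w2)) (layer (AF ++ wordE w1) g (wordE w2) h).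
Proof.
move=> eg cr; rewrite -[w1 ++ s' ++ w2]revK; have B_x d' a k b h' : 
    cupB A j d' (a ++ k :: b) h' ->
    cupB A j (d' + degX C k) (a ++ k :: b)
      (xlayer AF (rev (rcons b j)) k (rev a) h').
  exact: (cupB_egen (egen_X k)).
have B_t d' a l k b h' : cupB A j d' (a ++ l :: k :: b) h' ->
    cupB A j (d' + degT C l k) (a ++ k :: l :: b) (trlayer AF a l k (rcons b j) h').
  by rewrite degTC; exact: (cupB_egen (egen_T k l)).
have km := hvec_klr_rev AF; case: eg cr => [k|l k].
  rewrite rev_cat /= rev_cons cat_rcons => cr.
  have := crossed_cup (crossed_x (@degTxx _ C) km cupB_at B_x B_t cupB_last cr).
  by rewrite !revK.
have -> : rev (w1 ++ [:: l; k] ++ w2) = rev w2 ++ [:: k, l & rev w1].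
  by rewrite rev_cat /= !rev_cons !cat_rcons.
have -> : rev (w1 ++ [:: k; l] ++ w2) = rev w2 ++ [:: l, k & rev w1].
  by rewrite rev_cat /= !rev_cons !cat_rcons.
move=> cr; have := crossed_cup (crossed_t (@degTxx _ C) km cupB_at B_x B_t cupB_last cr).
by rewrite degTC /trlayer !revK.
Qed.

End CupB.

Lemma crossed_strand_egen A i s s' (g : tm K (wordE s) (wordE s')) e n d w1 w2 h :
  egen g e ->
  crossed (degT C) (tlayer A) i (strandB A i) n d (w1 ++ s ++ w2) h ->
  span (d + e) (A ++ wordE (w1 ++ s' ++ w2)) (layer (A ++ wordE w1) g (wordE w2) h).
Proof.
have km := hvec_klr D X0 A.
case=> [k|j k] cr.
  have := crossed_x (@degTxx _ C) km (@strandB_at A i) (@strandB_x A i)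
    (@strandB_t A i) (@strandB_last A i) cr.
  exact: crossed_strand.
have := crossed_t (@degTxx _ C) km (@strandB_at A i) (@strandB_x A i)
  (@strandB_t A i) (@strandB_last A i) cr.
exact: crossed_strand.
Qed.

(** Induction on the number of letters F and, inside, on the element of [span]. By interchange, a
    generator within the prefix acts on the diagram without its last strand; one among the trailing
    letters E is covered by [crossed_x] and [crossed_t]. *)
Lemma span_egen_all n : span_egen_below n.
Proof.
elim: n => [//|n IHn] s s' g e a b d h eg ab.
move En : (a ++ _) => Y sh.
elim: sh a b ab En => {d Y h} [d Y|d Y c h1 h2 _ s1 _ s2|d h Bh|A i u v d h Bh|
  A j u v r d h sh IHh] a b ab E.
- rewrite (linear_at0 (layer_linear _ _ _)); exact: span_0.
- rewrite layer_linear; apply: span_lin; [exact: s1 | exact: s2].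
- by case: eg E => [?|? ?]; case: a ab.
(* The prefix is first shortened so as not to end with a letter E; otherwise the generator could
   straddle its end. *)
- have [A1 [s0 [EA nE]]] := word_trailing A.
  rewrite {}EA in Bh E *; rewrite tlayer_shift.
  rewrite -catA -map_cat (catA s0) in Bh; rewrite -catA -map_cat (catA s0) in E.
  have [[c EA Eb]|[w1 [w2 [-> -> Ew]]]] := split_trailing nE E.
    rewrite {}Eb {}EA in Bh *; rewrite cross_left.
    rewrite -catA in Bh.
    have := B1_layer (egen_homog eg) (_ : B1 i d (a ++ wordE s ++ c ++ wordE _) h).
    rewrite -catA in Bh; move=> /(_ _ Bh) Bh'.
    apply: span_eq (span_strand (A := a ++ wordE s' ++ c) (u := s0 ++ u) _) _ _.
    - by rewrite -!catA in Bh' *; exact: Bh'.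
    - lia.
    - by rewrite -!catA.
  have cr : crossed (degT C) (tlayer A1) i (strandB A1 i) (size v)
      (d + cross_deg (degT C) i v) (w1 ++ s ++ w2)
      (cross (tlayer A1) i (s0 ++ u) v h).
    by rewrite -Ew; apply: crossed_gen.
  by have := crossed_strand_egen eg cr; rewrite -catA -!map_cat.
have [[c EA Eb]|[w1 [w2 [Ea Eb Ew]]]] := split_trailing (@not_endsE_F _ A j) E.
  (* [c] cannot be empty: the source of the generator ends with a letter E, but [A ++ [:: genF j]]
     ends with a letter F. *)
  case/lastP: c => [|c y] in EA Eb.
    have [w [k Es]] : endsE (wordE s).
      by case: (eg) => [k|l k]; [exists [::], k | exists [:: genE l], k].
    case: (@not_endsE_F _ A j); exists (a ++ w), k.
    by rewrite EA cats0 Es catA.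
  have [EA' Ey] : A = a ++ wordE s ++ c /\ genF j = y.
    by move: EA; rewrite -!rcons_cat cats1 => /rcons_inj[].
  rewrite -{}Ey -cats1 {y EA} in Eb; rewrite {}Eb {}EA' in E sh IHh ab *.
  have Ec x : (a ++ x ++ c) ++ [:: genF j] = a ++ x ++ (c ++ [:: genF j]).
    by rewrite -!catA.
  rewrite Ec crossr_left -!Ec cup_left.
  have IH : span (d + e) ((a ++ wordE s' ++ c) ++ wordE (rev (u ++ v)))
      (layer a g (c ++ wordE (rev (u ++ v))) h).
    rewrite -!catA; apply: IHh => //; last by rewrite -!catA.
    by move: ab; rewrite !count_cat !count_wordE /=; lia.
  have := span_cup j r IH.
  move=> /span_eq; apply; first lia.
  by rewrite -!catA.
rewrite {}Ea {}Eb in ab *.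
have cr : crossed (degT C) (trlayer (A ++ [:: genF j])) j (cupB A j) (size v)
    (d + degX C j * r%:Z + cross_deg (degT C) j v) (rev (w1 ++ s ++ w2))
    (cross (trlayer (A ++ [:: genF j])) j u v (cup A j r (wordE (rev (u ++ v))) h)).
  by rewrite -Ew revK; apply: crossed_gen => //; exact: cupB_cup.
have IH : span_egen_below (count isF A).+1.
  move=> s1 s1' g1 e1 a1 b1 d1 h1 eg1 cA; apply: IHn => //.
  (* The letter [genF j] is counted in [ab] and is not part of [A], which makes up for the
     successor. *)
  move: ab cA; rewrite !count_cat !count_wordE /=; lia.
by have := crossed_cup_egen IH eg cr; rewrite !map_cat catA.
Qed.

Lemma span_T d a j k b h : span d (a ++ [:: genE j, genE k & b]) h ->
  span (d + degT C j k) (a ++ [:: genE k, genE j & b]) (layer a (tm_T j k) b h).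
Proof. exact: (span_egen_all (egen_T j k) (ltnSn _)). Qed.

Lemma span_X d a k b h : span d (a ++ genE k :: b) h ->
  span (d + degX C k) (a ++ genE k :: b) (layer a (tm_X k) b h).
Proof. exact: (span_egen_all (egen_X k) (ltnSn _)). Qed.

Lemma span_cross A j u v d h : span d (A ++ wordE (rev (rcons (u ++ v) j))) h ->
  span (d + cross_deg (degT C) j v) (A ++ wordE (rev (u ++ j :: v)))
    (cross (trlayer A) j u v h).
Proof.
elim: v u h => [|k v IHv] u h /=.
  by rewrite cats0 cats1 /cross_deg big_nil addr0.
rewrite -(cat_rcons k) => /IHv; rewrite cross_deg_cons => sh.
have Er x y : A ++ wordE (rev (u ++ [:: x, y & v]))
    = (A ++ wordE (rev v)) ++ [:: genE y, genE x & wordE (rev u)].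
  by rewrite rev_cat !rev_cons !cat_rcons map_cat catA.
rewrite cat_rcons Er in sh; rewrite Er.
by apply: span_eq (span_T sh) _ _ => //; rewrite [degT C j k]degTC; lia.
Qed.

(** With only letters E to its right, the cup is itself the last strand to enter, with no dots and
    no crossings. *)
Lemma span_eta_trailing d a i w h : span d (a ++ wordE w) h ->
  span d (a ++ [:: genF i; genE i] ++ wordE w) (layer a (tm_eta i) (wordE w) h).
Proof.
move=> sh; have := @span_cup a i (rev w) [::] 0 d h.
rewrite cats0 revK => /(_ sh) /span_eq; apply.
  by rewrite mulr0 !addr0 /cross_deg big_nil addr0.
by rewrite rev_cat revK -catA.
Qed.

(** If some letter to the right of the cup is an F, the cup lies to the left of the path of the last
    strand, commutes with it and acts on the other strands. *)
Lemma span_eta d a i b h : span d (a ++ b) h ->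
  span d (a ++ [:: genF i; genE i] ++ b) (layer a (tm_eta i) b h).
Proof.
have [[w ->]|nb] := pselect (exists w, b = wordE w); first exact: span_eta_trailing.
move En : (a ++ b) => Y sh.
elim: sh a b nb En => {d Y h} [d Y|d Y c h1 h2 _ s1 _ s2|d h Bh|A k u v d h Bh|
  A j u v r d h sh IHh] a b nb E.
- rewrite (linear_at0 (layer_linear _ _ _)); exact: span_0.
- rewrite layer_linear; apply: span_lin; [exact: s1 | exact: s2].
- by case: a b E nb => // -[|//] _ []; exists [::].
- case: (cat_eq_cat E) => [[c EA Eb]|[c _ /wordE_cat_inv[_ [w [_ _ Eb]]]]]; last first.
    by case: nb; exists w.
  rewrite {}Eb {}EA in Bh *.
  have := @cross_left a [::] _ (tm_eta i) c k u v h; rewrite /= => ->.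
  have := B1_layer (homog_eta K C i) (_ : B1 k d (a ++ [::] ++ c ++ wordE _) h).
  rewrite -catA in Bh; move=> /(_ _ Bh) Bh'.
  apply: span_eq (span_strand (A := a ++ [:: genF i; genE i] ++ c) _) _ _.
  - by rewrite -!catA in Bh' *; exact: Bh'.
  - lia.
  - by rewrite -!catA.
case: (cat_eq_cat E) => [[c EA Eb]|[c _ /wordE_cat_inv[_ [w [_ _ Eb]]]]]; last first.
  by case: nb; exists w.
case/lastP: c => [|c y] in EA Eb; first by case: nb; exists (rev (u ++ j :: v)).
have [EA' Ey] : A = a ++ c /\ genF j = y.
  by move: EA; rewrite -!rcons_cat cats1 => /rcons_inj[].
rewrite -{}Ey -cats1 {y EA} in Eb; rewrite {}Eb {}EA' in E sh IHh nb *.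
have Ec x : (a ++ x ++ c) ++ [:: genF j] = a ++ x ++ (c ++ [:: genF j]).
  by rewrite -!catA.
rewrite -[(a ++ c) ++ _]/((a ++ [::] ++ c) ++ _) Ec crossr_left -!Ec.
rewrite (@cup_left a [::] _ (tm_eta i) c).
(* Without [genF j] the letters to the right of the new cup may all be E; the cup is then the last
   strand of the remaining diagram. *)
have [[w Ew]|nc] := pselect (exists w, c ++ wordE (rev (u ++ v)) = wordE w).
  have := @span_eta_trailing d a i w h; rewrite -Ew catA => /(_ sh) IH.
  apply: span_eq (span_cup j r (A := a ++ [:: genF i; genE i] ++ c) _) _ _.
  - by rewrite -!catA in IH *; exact: IH.
  - by [].
  - by rewrite -!catA.
apply: span_eq (span_cup j r (A := a ++ [:: genF i; genE i] ++ c) _) _ _.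
- rewrite -!catA; apply: IHh => //; by rewrite -catA.
- by [].
- by rewrite -!catA.
Qed.

Lemma adjE_layers a i W (h : hv) : hat (a ++ genE i :: W) h ->
  layer a (tm_eps i) (genE i :: W) (layer (a ++ [:: genE i]) (tm_eta i) W h) = h.
Proof.
move=> hh; have := layer_eqv a W h (rel_adjE D i).
rewrite layer_comp (layer_whiskerr _ [:: genE i] (tm_eps i)).
by rewrite (layer_whiskerl _ [:: genE i] (tm_eta i)) layer_id.
Qed.

(** If the cap ends at the letter F where the last strand enters, the zigzag relation straightens
    that strand: what remains are its dots and crossings on top of an element of [span], covered by
    [span_X] and [span_cross]. Otherwise the cap lies to the left of the last strand and acts on the
    rest. *)
Lemma span_eps d a i b h : span d (a ++ [:: genE i; genF i] ++ b) h ->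
  span d (a ++ b) (layer a (tm_eps i) b h).
Proof.
move En : (a ++ _) => Y sh.
elim: sh a b En => {d Y h} [d Y|d Y c h1 h2 _ s1 _ s2|d h Bh|A k u v d h Bh|
  A j u v r d h sh IHh] a b E.
- rewrite (linear_at0 (layer_linear _ _ _)); exact: span_0.
- rewrite layer_linear; apply: span_lin; [exact: s1 | exact: s2].
- by case: a E.
- have [c EA Eb] := split_EF E.
  rewrite {}Eb {}EA in Bh *.
  have := @cross_left a _ [::] (tm_eps i) c k u v h; rewrite /= => ->.
  have := B1_layer (homog_eps K C i) (_ : B1 k d (a ++ _ ++ c ++ wordE _) h).
  rewrite -catA in Bh; move=> /(_ _ Bh) Bh'.
  apply: span_eq (span_strand (A := a ++ c) _) _ _.
  - by rewrite -!catA in Bh' *; exact: Bh'.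
  - lia.
  - by rewrite -!catA.
have [c EA Eb] := split_EF E.
case/lastP: c => [|c y] in EA Eb.
  have [EA' Ey] : A = a ++ [:: genE i] /\ genF j = genF i.
    have Er : a ++ [:: genE i; genF i] = rcons (a ++ [:: genE i]) (genF i).
      by rewrite -cats1 -catA.
    by move: EA; rewrite cats0 Er cats1 => /rcons_inj[-> ->].
  case: Ey => Ey; subst j; rewrite {}Eb {}EA' in E sh IHh *.
  have -> : (a ++ [:: genE i]) ++ [:: genF i] = a ++ [:: genE i; genF i] ++ [::].
    by rewrite -catA.
  rewrite crossr_left /= !cats0; apply: span_cross.
  rewrite rev_rcons.
  set W := wordE (rev (u ++ v)).
  have -> : layer a (tm_eps i) (genE i :: W) (cup (a ++ [:: genE i]) i r W h)
      = iter r (layer a (tm_X i) W) h.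
    have EF : (a ++ [:: genE i]) ++ [:: genF i] = a ++ [:: genE i; genF i] ++ [::].
      by rewrite -catA.
    rewrite /cup EF; elim: r {E} => [|r IHr].
      by rewrite adjE_layers //; apply: (span_hat (d := d)); rewrite -catA in sh.
    by rewrite !iterS (layer_far a (tm_eps i) [::] (tm_X i) W) IHr /= cats0.
  elim: r {E} => [|r IHr] /=; first by rewrite mulr0 addr0; rewrite -catA in sh.
  by apply: span_eq (span_X IHr) _ _ => //; lia.
have [EA' Ey] : A = a ++ [:: genE i; genF i] ++ c /\ genF j = y.
  by move: EA; rewrite -!rcons_cat cats1 => /rcons_inj[].
rewrite -{}Ey -cats1 {y EA} in Eb; rewrite {}Eb {}EA' in E sh IHh *.
have Ec x : (a ++ x ++ c) ++ [:: genF j] = a ++ x ++ (c ++ [:: genF j]).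
  by rewrite -!catA.
rewrite Ec crossr_left -!Ec cup_left.
apply: span_eq (span_cup j r (A := a ++ c) _) _ _.
- by rewrite -!catA; apply: IHh; rewrite -!catA.
- by [].
- by rewrite -!catA.
Qed.

Lemma span_layer S T (g : tm K S T) e : tm_homog C e g -> forall a b d h,
  span d (a ++ S ++ b) h -> span (d + e) (a ++ T ++ b) (layer a g b h).
Proof.
elim=> {S T e g}.
- by move=> S a b d h sh; rewrite addr0 layer_id //; exact: span_hat sh.
- move=> S T U d e f g _ IHf _ IHg a b d' h sh; rewrite layer_comp.
  by apply: span_eq (IHf _ _ _ _ (IHg _ _ _ _ sh)) _ _ => //; lia.
- move=> S T S' T' d e f g _ IHf _ IHg a b d' h sh.
  have -> : layer a (tm_tens f g) b h
      = layer a f (T' ++ b) (layer (a ++ S) g b h).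
    rewrite -layer_whiskerr -layer_whiskerl -layer_comp; apply: layer_eqv.
    apply: eqv_trans (eqv_interchange _ _ _ _ _); apply: eqv_tens; apply: eqv_sym.
      exact: eqv_comp1r.
    exact: eqv_comp1l.
  rewrite -catA; apply: span_eq (IHf a (T' ++ b) (d' + e) _ _) _ _ => //; last lia.
  by have := IHg (a ++ S) b d' h; rewrite -!catA; apply; rewrite -catA in sh.
- by move=> S T e a b d h _; rewrite layer0; exact: span_0.
- move=> S T e f g _ IHf _ IHg a b d h sh; rewrite layerD -[layer a f b h]scale1r.
  by apply: span_lin; [exact: IHf | exact: IHg].
- by move=> S T e c f _ IHf a b d h sh; rewrite layerZ; apply: spanZ; exact: IHf.
- by move=> i a b d h; exact: span_X.
- by move=> i j a b d h; exact: span_T.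
- by move=> i a b d h sh; rewrite addr0; exact: span_eta.
- by move=> i a b d h sh; rewrite addr0; exact: span_eps.
Qed.

End SpanningSet.

(** * The degree bound on the spanning set *)

Section SpanVanishing.
Variables (K : fieldType) (I : finType) (C : sym_cartan I) (D : qdata K C).

Definition degX_max : nat := \max_(i : I) (2 * symd C i).

(** The square fits the removal of one strand: it crosses at most n letters, hence lowers the degree
    by at most [degX_max * n], which is less than the growth of the bound from n to n + 1 allows. *)
Definition deg_bound (n : nat) : int := - (degX_max * n ^ 2)%:Z.

Lemma degX_le i : degX C i <= degX_max%:Z.
Proof. by rewrite lez_nat; exact: leq_bigmax. Qed.

(** Only crossings of strands with the same label have negative degree. *)
Lemma degT_ge i j : - degX_max%:Z <= degT C i j.
Proof.
have [->|ij] := eqVneq i j; first by rewrite degTxx lerN2; exact: degX_le.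
apply: (@le_trans _ _ 0); first by rewrite oppr_le0.
by rewrite /degT oppr_ge0 mulr_ge0_le0 // cartan_offdiag.
Qed.

Lemma cross_deg_ge i v : - (degX_max * size v)%:Z <= cross_deg (degT C) i v.
Proof.
elim: v => [|k v IHv]; first by rewrite /cross_deg big_nil muln0 oppr0.
by rewrite cross_deg_cons /= mulnS PoszD opprD lerD // degT_ge.
Qed.

Lemma deg_bound_cross n d i v : (size v <= n)%N ->
  d + cross_deg (degT C) i v < deg_bound n.+1 -> d < deg_bound n.
Proof.
rewrite /deg_bound => vn; have := cross_deg_ge i v.
have : (degX_max * size v <= degX_max * n)%N by rewrite leq_mul2l vn orbT.
have : (degX_max * n.+1 ^ 2 = degX_max * n ^ 2 + degX_max * n + degX_max * n + degX_max)%N.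
  by rewrite -!mulnDr -mulnSr; congr (_ * _)%N; lia.
move: (degX_max * size v)%N (degX_max * n)%N (degX_max * n ^ 2)%N (_ * _)%N => *.
lia.
Qed.

(** Removing the last strand shortens the target. Dots only raise the degree, and by
    [deg_bound_cross] the rest of the diagram is still below the bound for the smaller size. *)
Lemma span_vanish (X0 : word I) (B0 : int -> hvec D X0 -> Prop) B1 :
  (forall d h, B0 d h -> d < 0 -> h = 0) ->
  (forall i d Y h n, B1 i d Y h -> (size X0 + size Y <= n)%N ->
     d < deg_bound n -> h = 0) ->
  forall d Y h, span B0 B1 d Y h ->
  forall n, (size X0 + size Y <= n)%N -> d < deg_bound n -> h = 0.
Proof.
move=> B0v B1v d Y h; elim=> {d Y h} [//|d Y a h h' _ IHh _ IHh'|d h Bh|A i u v d h Bh|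
  A j u v r d h sh IHh] n Yn dn.
- by rewrite (IHh n) // (IHh' n) // scaler0 addr0.
- by apply: B0v Bh _; apply: lt_le_trans dn _; rewrite oppr_le0.
- case: n => [|n] in Yn dn; first by rewrite !size_cat map_cat size_cat /= in Yn; lia.
  rewrite (B1v _ _ _ _ n Bh).
  + exact: linear_at0 (cross_linear (hvec_klr D X0 A) i u v).
  + by move: Yn; rewrite !map_cat !size_cat /=; lia.
  + by apply: deg_bound_cross dn; move: Yn; rewrite !map_cat !size_cat /= !size_map; lia.
have En : exists n', n = n'.+1.
  by case: n Yn {dn} => [|n]; [rewrite !size_cat /=; lia | exists n].
case: En Yn dn => {}n -> Yn dn.
have h0 : h = 0.
  apply: (IHh n).
  + by move: Yn; rewrite !size_cat !size_map !size_rev !size_cat /=; lia.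
  + have : d + degX C j * r%:Z < deg_bound n.
      apply: deg_bound_cross dn.
      by move: Yn; rewrite !size_cat !size_map !size_rev !size_cat /=; lia.
    by apply: le_lt_trans; rewrite lerDl mulr_ge0.
have cup0 : cup A j r (wordE (rev (u ++ v))) h = 0.
  rewrite /cup h0; elim: r {dn} => [|r IHr] /=; last rewrite IHr;
    exact: linear_at0 (layer_linear _ _ _).
by rewrite cup0; exact: linear_at0 (cross_linear (hvec_klr_rev D X0 _) j u v).
Qed.

End SpanVanishing.

(** * Vanishing of Hom spaces in low degree, by induction on the source *)

Section Vanishing.
Variables (K : fieldType) (I : finType) (C : sym_cartan I) (D : qdata K C).

Definition vanishing (X : word I) := forall Y d (f : tm K X Y), tm_homog C d f ->
  d < deg_bound C (size X + size Y) -> tm_eqv D f (tm_zero X Y).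

Lemma layer_nil X0 S T (g : tm K S T) (h : hvec D X0) : layer [::] g [::] h = post g h.
Proof.
apply: post_heqv; apply: (tm_heqv_trans (tm_heqvW (eqv_tens1l _ _))).
by exists (cats0 _), (cats0 _); exact: eqv_tens1r.
Qed.

(** Carries the vanishing for source [X] over to a source with one more letter [l], whose strand
    goes straight up. *)
Inductive rwhisker (X : word I) l : int -> word I -> hvec D X ->
    hvec D (X ++ [:: l]) -> Prop :=
| rwhisker_tens d Y (f : tm K X Y) : tm_homog C d f ->
    @rwhisker X l d Y (hsingle D f) (hsingle D (tm_tens f (tm_id [:: l]))).

Lemma rwhisker_layer X l d Y h h' S T (g : tm K S T) e a b :
  tm_homog C e g -> @rwhisker X l d Y h h' -> Y = a ++ S ++ b ->
  rwhisker (d + e) (a ++ T ++ b) (layer a g b h) (layer a g (b ++ [:: l]) h').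
Proof.
move=> hg [{}d {}Y f hf] E; subst Y.
pose k := tm_tens (tm_id a) (tm_tens g (tm_id b)).
have -> : layer a g b (hsingle D f) = hsingle D (tm_comp k f) by exact: post_single.
have -> : layer a g (b ++ [:: l]) (hsingle D (tm_tens f (tm_id [:: l])))
    = hsingle D (tm_tens (tm_comp k f) (tm_id [:: l])).
  have kl x : layer a g (b ++ [:: l]) x = post (tm_tens k (tm_id [:: l])) x.
    apply: post_heqv; apply: (fun p => tm_heqv_trans p (tm_heqv_tensA _ _ _ _)).
    apply: tm_heqv_tens (tm_heqv_refl _ _) _.
    apply: (fun p => tm_heqv_trans p (tm_heqv_tensA _ _ _ _)).
    apply: tm_heqv_tens (tm_heqv_refl _ _) _; apply: tm_heqvW.
    by apply: eqv_sym; exact: eqv_tens11.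
  rewrite kl post_single; apply/hsingle_eqv.
  apply: eqv_trans (eqv_sym (eqv_interchange _ _ _ _ _)) _.
  by apply: eqv_tens; [exact: eqv_refl | exact: eqv_comp1l].
apply: rwhisker_tens.
have -> : d + e = 0 + (e + 0) + d by lia.
by apply: homog_comp => //; do !apply: homog_tens => //; exact: homog_id.
Qed.

Lemma hsingle0 X Y : hsingle D (tm_zero X Y) = 0.
Proof. exact: linear_at0 (@dsingle_linear _ _ (fun Y => A2Q_hom D X Y : lmodType K) Y). Qed.

Lemma rwhisker_vanish X l d Y h h' : vanishing X -> @rwhisker X l d Y h h' ->
  d < deg_bound C (size X + size Y) -> h' = 0.
Proof.
move=> vX [{}d {}Y f hf] dn.
rewrite -(hsingle0 _ (Y ++ [:: l])); apply/hsingle_eqv.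
apply: eqv_trans (eqv_tens (vX _ _ _ hf dn) (eqv_refl _ _)) _.
apply/tm_classP; rewrite -[tm_class D (tm_zero _ _)](scale0r (tm_class D
  (tm_tens (tm_zero X Y) (tm_id [:: l])))) -tm_classZ.
apply/tm_classP; apply: eqv_trans (eqv_tensZl _ _ _ _).
apply: eqv_tens; last exact: eqv_refl.
by apply/tm_classP; rewrite tm_classZ scale0r.
Qed.

Lemma deg_bound_le m n : (m <= n)%N -> deg_bound C n <= deg_bound C m.
Proof. by move=> mn; rewrite lerN2 lez_nat leq_mul2l leq_exp2r // mn orbT. Qed.

(** Every morphism is obtained by postcomposing the identity of [X], so stability of the span puts
    it in the span. *)
Lemma vanishing_of_span (X : word I) (B0 : int -> hvec D X -> Prop) B1 :
  (forall S T (g : tm K S T) e, tm_homog C e g -> forall a b d h,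
     span B0 B1 d (a ++ S ++ b) h -> span B0 B1 (d + e) (a ++ T ++ b) (layer a g b h)) ->
  span B0 B1 0 X (hsingle D (tm_id X)) ->
  (forall d h, B0 d h -> d < 0 -> h = 0) ->
  (forall i d Y h n, B1 i d Y h -> (size X + size Y <= n)%N ->
     d < deg_bound C n -> h = 0) ->
  vanishing X.
Proof.
move=> spl sid B0v B1v Y d f hf dn.
have sf : span B0 B1 d Y (hsingle D f).
  have := spl _ _ _ _ hf [::] [::] 0 (hsingle D (tm_id X)).
  rewrite /= !cats0 add0r layer_nil post_single => /(_ sid).
  by rewrite (proj2 (hsingle_eqv D _ _) (eqv_comp1r D f)).
apply/hsingle_eqv; rewrite hsingle0.
exact: span_vanish B0v B1v _ _ _ sf _ (leqnn _) dn.
Qed.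

Lemma vanishing_nil : vanishing [::].
Proof.
pose B0 (d : int) (h : hvec D [::]) := d = 0 /\ h = hsingle D (tm_id [::]).
pose B1 (i : I) (d : int) (Y : word I) (h : hvec D [::]) := False.
apply: (@vanishing_of_span [::] B0 B1).
- move=> S T g e hg; apply: span_layer hg => // d h [_ ->]; exact: hat_single.
- by apply: span_base.
- by move=> d h [->]; rewrite ltxx.
- by [].
Qed.

Lemma vanishing_E X i : vanishing X -> vanishing (X ++ [:: genE i]).
Proof.
move=> vX.
pose B0 (d : int) (h : hvec D (X ++ [:: genE i])) := False.
(* The last strand goes straight up from the final letter and carries [r] dots, next to a morphism
   of degree [d'] from [X]. *)
pose B1 (j : I) (d : int) (Y : word I) (h : hvec D (X ++ [:: genE i])) :=
  j = i /\ exists r d' h0 h', [/\ @rwhisker X (genE i) d' Y h0 h',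
    d = d' + degX C i * r%:Z & h = iter r (layer Y (tm_X i) [::]) h'].
apply: (@vanishing_of_span (X ++ [:: genE i]) B0 B1).
- move=> S T g e hg; apply: span_layer hg => //.
  + move=> j d Y h [-> [[|r] [d' [h0 [h' [rw _ ->]]]]]] /=.
      by case: rw => *; exact: hat_single.
    by have := hat_layer (a := Y) (tm_X i) (b := [::]).
  + move=> j S' T' g' e' a b d h hg' [-> [r [d' [h0 [h' [rw -> ->]]]]]]; split=> //.
    exists r, (d' + e'), (layer a g' b h0), (layer a g' (b ++ [:: genE i]) h').
    split; [exact: (rwhisker_layer hg' rw) | lia |].
    elim: r => [//|r IHr] /=; rewrite -IHr.
    by have := layer_far a g' b (tm_X i) [::]; rewrite /= => ->.
  + move=> j d Y h [-> [r [d' [h0 [h' [rw -> ->]]]]]]; split=> //.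
    by exists r.+1, d', h0, h'; split=> //; lia.
(* The identity has a last strand without dots and crossings. *)
- have := @span_strand _ _ _ D _ B0 B1 X i [::] [::] 0 (hsingle D (tm_id _)).
  rewrite /= cats0 /cross_deg big_nil addr0; apply; split=> //.
  exists 0%N, 0, (hsingle D (tm_id X)), (hsingle D (tm_tens (tm_id X) (tm_id [:: genE i]))).
  split; [by apply: rwhisker_tens; exact: homog_id | by rewrite mulr0 |].
  rewrite /=; by apply/hsingle_eqv; apply: eqv_sym; exact: eqv_tens11.
- by [].
move=> j d Y h n [_ [r [d' [h0 [h' [rw -> ->]]]]]] sn dn.
rewrite (rwhisker_vanish vX rw).
  by elim: r {dn} => [//|r IHr] /=; rewrite IHr; exact: linear_at0 (layer_linear _ _ _).
apply: lt_le_trans (le_lt_trans _ dn) _; first by rewrite lerDl mulr_ge0.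
by apply: deg_bound_le; move: sn; rewrite size_cat /=; lia.
Qed.

(* The adjunction bends the last strand of X F_i upwards: f is recovered from *)
(* (f E_i) (X eta_i) : X -> Y E_i, which vanishes by assumption on X.         *)
Lemma vanishing_F X i : vanishing X -> vanishing (X ++ [:: genF i]).
Proof.
move=> vX Y d f hf dn; set X1 := X ++ [:: genF i].
pose id1 : hvec D X1 := hsingle D (tm_id X1).
have rw0 : rwhisker 0 X (hsingle D (tm_id X)) id1.
  have <- : hsingle D (tm_tens (tm_id X) (tm_id [:: genF i])) = id1.
    by apply/hsingle_eqv; exact: eqv_tens11.
  by apply: rwhisker_tens; exact: homog_id.
have rw1 := rwhisker_layer (a := X) (b := [::]) (homog_eta K C i) rw0 _.
have {rw1} := rw1 (esym (cats0 X)).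
have rw2 := rwhisker_layer (a := [::]) (b := [:: genE i]) hf _ _.
move=> /rw2 rw3; have {rw2 rw3} := rw3 _.
rewrite /X1 -catA /= => /(_ erefl) rw.
set v1 := layer X (tm_eta i) [:: genF i] id1 in rw.
(* This is (f E_i) (X eta_i) with a strand F_i added on the right. Bending moves one letter from
   source to target, so the total size and the bound stay the same. *)
have v2 : layer [::] f [:: genE i; genF i] v1 = 0.
  apply: rwhisker_vanish vX rw _; apply: lt_le_trans _ (deg_bound_le _).
    by rewrite !addr0 add0r; exact: dn.
  by rewrite !size_cat /=; lia.
have v3 : layer X1 (tm_eps i) [::] v1 = id1.
  have := layer_eqv X [::] id1 (rel_adjF D i).
  rewrite layer_comp (layer_whiskerl _ [:: genF i] (tm_eps i)).
  rewrite (layer_whiskerr _ [:: genF i] (tm_eta i)) => ->.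
  by rewrite layer_id // /X1; exact: hat_single.
apply/hsingle_eqv; rewrite hsingle0.
have -> : hsingle D f = layer [::] f [::] id1.
  by rewrite layer_nil post_single; apply/hsingle_eqv; apply: eqv_sym; exact: eqv_comp1r.
(* The identity is replaced by the zigzag, and the interchange law moves the cap above [f]. *)
rewrite -v3; have := layer_far [::] f [::] (tm_eps i) [::] v1.
rewrite /= !cats0 => ->; rewrite v2; exact: linear_at0 (layer_linear _ _ _).
Qed.

Theorem hom_vanishing X : vanishing X.
Proof.
elim/last_ind: X => [|X [i|i] IHX]; first exact: vanishing_nil;
  rewrite -cats1; [exact: vanishing_E | exact: vanishing_F].
Qed.

End Vanishing.

(** * Coproducts of presheaves with finitely many nonzero summands at each object *)

Lemma linear_at_sum (K : fieldType) (H H' : lmodType K) (f : H -> H') (S : Type)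
    (e : seq S) (F : S -> H) : linear f ->
  f (\sum_(s <- e) F s) = \sum_(s <- e) f (F s).
Proof.
move=> fl; apply: (big_morph f); last exact: linear_at0.
by move=> u v; have := fl 1 u v; rewrite !scale1r.
Qed.

Lemma eq_sum_support (V : zmodType) (S : eqType) (e1 e2 : seq S) (F : S -> V) :
  uniq e1 -> uniq e2 ->
  (forall s, s \notin e1 -> F s = 0) -> (forall s, s \notin e2 -> F s = 0) ->
  \sum_(s <- e1) F s = \sum_(s <- e2) F s.
Proof.
move=> u1 u2 F1 F2.
have restrict (e e' : seq S) : (forall s, s \notin e' -> F s = 0) ->
    \sum_(s <- e) F s = \sum_(s <- [seq s <- e | s \in e']) F s.
  by move=> Fe'; rewrite big_filter [LHS](bigID (mem e')) /= [X in _ + X]big1 ?addr0.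
rewrite (restrict e1 e2) // (restrict e2 e1) //; apply: perm_big.
apply: uniq_perm; rewrite ?filter_uniq // => s.
by rewrite !mem_filter andbC.
Qed.

Section LocallyFiniteBiproduct.
Variables (K : fieldType) (A : lincat K) (S : eqType) (Y : S -> presheaf A).
Hypothesis Y_finite :
  forall X : A, exists e : seq S, forall s, s \notin e -> forall y : Y s X, y = 0.

Definition ps_prod : presheaf A.
Proof.
exists (fun X => dfun (fun s => Y s X) : lmodType K)
  (fun X X' f x s => ps_map (p := Y s) f (x s)).
- by move=> X X' f a x x'; apply: dfunP => s; exact: ps_map_linear.
- by move=> X X' x a f f'; apply: dfunP => s; exact: ps_linear.
- by move=> X x; apply: dfunP => s; exact: ps_id.
- by move=> X X' X'' f g x; apply: dfunP => s; exact: ps_comp.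
Defined.

Definition ps_proj s : psmor ps_prod (Y s).
Proof. by exists (fun X x => x s). Defined.

Lemma ps_prodP : is_product ps_proj.
Proof.
move=> Z f; have [h hE] : exists h : psmor Z ps_prod, forall X z s, h X z s = f s X z.
  unshelve eexists (@PsMor K A Z ps_prod (fun X z s => f s X z) _ _) => //.
  - by move=> X a z z'; apply: dfunP => s; exact: pm_linear.
  - by move=> X X' g z; apply: dfunP => s; exact: pm_natural.
exists h; split=> [s|h' h'E]; apply: psmor_eq => X z; first exact: hE.
by apply: dfunP => s; rewrite hE -h'E.
Qed.

Definition ps_inj s : psmor (Y s) ps_prod.
Proof.
exists (fun X y => dsingle (V := fun s => Y s X) y).
- by move=> X; exact: (@dsingle_linear K S (fun s => Y s X) s).
- move=> X X' f y; apply: dfunP => s' /=.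
  have [e|ne] := pselect (s = s'); first by case: s' / e; rewrite !dsingleE.
  by rewrite !dsingle_neq // (linear_at0 (ps_map_linear f)).
Defined.

Definition ps_support X : seq S := undup (projT1 (cid (Y_finite X))).

Lemma ps_supportP X s : s \notin ps_support X -> forall y : Y s X, y = 0.
Proof. by rewrite mem_undup; exact: (projT2 (cid (Y_finite X))). Qed.

Lemma ps_support_uniq X : uniq (ps_support X).
Proof. exact: undup_uniq. Qed.

(** The inverse of the canonical map sends a family to the sum of the injections of its components,
    a finite sum at each object by [Y_finite]. *)
Lemma locally_finite_biproduct (P : presheaf A) (inj : forall s, psmor (Y s) P) :
  is_coproduct inj -> is_biproduct inj.
Proof.
move=> hP; split=> //; have [c [cE _]] := hP _ ps_inj.
have cE' s X y : c X (inj s X y) = dsingle (V := fun s => Y s X) y.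
  by rewrite -[LHS]/(pm_comp c (inj s) X y) cE.
have inj0 s X : inj s X 0 = 0 by exact: linear_at0 (@pm_linear _ _ _ _ (inj s) X).
pose gfun X (x : ps_prod X) := \sum_(s <- ps_support X) inj s X (x s).
have gl X : linear (@gfun X).
  move=> a x x'; rewrite /gfun scaler_sumr -big_split.
  by apply: eq_bigr => s _; exact: pm_linear.
have gn X X' f (x : ps_prod X') : gfun X (ps_map f x) = ps_map f (gfun X' x).
  rewrite /gfun (linear_at_sum _ _ (ps_map_linear f)) /=.
  under [RHS]eq_bigr do rewrite -pm_natural.
  (* The lists chosen at [X] and at [X'] are unrelated, but a summand missing from either of them
     vanishes. *)
  apply: eq_sum_support; rewrite ?ps_support_uniq // => s sX.
    by rewrite (ps_supportP sX (ps_map _ _)) inj0.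
  by rewrite (ps_supportP sX (x s)) (linear_at0 (ps_map_linear f)) inj0.
pose g := PsMor gl gn.
exists ps_prod, ps_proj, c; split.
- exact: ps_prodP.
- split=> [s|s s' ss']; apply: psmor_eq => X y /=; rewrite cE'.
    by rewrite dsingleE.
  by rewrite dsingle_neq.
exists g; split.
  (* Uniqueness in the universal property of [P] reduces the identity on [P] to a check on each
     summand. *)
  have [h [_ huniq]] := hP _ inj.
  rewrite -(huniq (pm_id P)); last by move=> s; exact: psmor_eq.
  apply/esym/huniq => s; apply: psmor_eq => X y /=; rewrite cE' /gfun.
  have [sX|sX] := boolP (s \in ps_support X).
    rewrite (bigD1_seq s) ?ps_support_uniq //= dsingleE big1 ?addr0 // => s' ss'.
    by rewrite dsingle_neq //; apply/eqP; rewrite eq_sym.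
  rewrite (ps_supportP sX y) inj0 big1 // => s' _.
  by rewrite (linear_at0 (@dsingle_linear _ _ (fun s => Y s X) s)) inj0.
apply: psmor_eq => X x; apply: dfunP => s /=.
rewrite /gfun (linear_at_sum _ _ (@pm_linear _ _ _ _ c X)).
under eq_bigr do rewrite cE'.
rewrite (big_morph (fun f : dfun (fun s => Y s X) => f s) (id1 := 0) (op1 := +%R)) //.
have [sX|sX] := boolP (s \in ps_support X); last first.
  rewrite (ps_supportP sX (x s)) big1_seq // => s' /andP[_ s'X].
  by rewrite dsingle_neq //; apply/eqP; apply: contraNneq sX => <-.
rewrite (bigD1_seq s) ?ps_support_uniq //= dsingleE big1 ?addr0 // => s' ss'.
by rewrite dsingle_neq //; exact/eqP.
Qed.

End LocallyFiniteBiproduct.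

(** * Left-bounded families of shifted representable presheaves *)

Lemma A2C_hom_vanish (K : fieldType) (I : finType) (C : sym_cartan I)
    (D : qdata K C) (X Y : A2C D) (f : lc_hom X Y) :
  a2c_shift X - a2c_shift Y < deg_bound C (size (a2c_word X) + size (a2c_word Y)) ->
  f = 0.
Proof.
move=> dn; apply: val_inj; case: f => h /= /A2Q_degP[t ht ->].
by apply/tm_classP; exact: hom_vanishing ht dn.
Qed.

Theorem lemma3p26 (K : fieldType) (I : finType) (C : sym_cartan I)
    (D : qdata K C) (n : nat) (F : 'I_n -> A2C D) (k : 'I_n -> int -> nat)
    (hk : left_bounded k)
    (P : Pre2 D)
    (inj : forall s : lf_index k,
       psmor (lf_family (fun m => yoneda (F m)) s) P)
    (hP : is_coproduct inj) :
  is_biproduct inj.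
Proof.
apply: (@locally_finite_biproduct K (A2C D) (lf_index k) _ _ P inj hP) => X.
have [l0 kl0] := hk.
(* At [X], the summand q^l F_m is Hom(q^(-l) X, F_m), which is zero once l - l0 exceeds [top m].
   Only the shifts from l0 to l0 + [N] remain. *)
pose top m := a2c_shift X - a2c_shift (F m)
  - deg_bound C (size (a2c_word X) + size (a2c_word (F m))) - l0.
pose N := (\max_m `|top m|)%N.
pose summand l m (a : 'I_(k m l)) : lf_index k :=
  Tagged (fun l => {m : 'I_n & 'I_(k m l)}) (Tagged (fun m => 'I_(k m l)) a).
exists (flatten [seq flatten [seq [seq summand (l0 + i%:Z) m a
  | a <- enum 'I_(k m (l0 + i%:Z))] | m <- enum 'I_n] | i <- iota 0 N.+1]) => -[l [m a]] nes y.
(* Below [l0] the multiplicity is zero, so there is no index [a]. *)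
have [ll0|l0l] := ltP l l0.
  by move: (ltn_ord a); move: (nat_of_ord a) => a'; rewrite kl0.
apply: A2C_hom_vanish; rewrite /=.
have topN : (`|top m| <= N)%N by exact: (@leq_bigmax _ (fun m => `|top m|%N)).
suff : N%:Z < l - l0.
  by move: topN; rewrite /top; move: (deg_bound _ _) => b; lia.
rewrite ltNge; apply: contraNN nes => lN.
have El : l = l0 + `|l - l0|%N%:Z by lia.
apply/flattenP; exists (flatten [seq [seq summand l m a | a <- enum 'I_(k m l)]
  | m <- enum 'I_n]).
  apply/mapP; exists `|l - l0|%N; last by rewrite -El.
  by rewrite mem_iota /=; lia.
apply/flattenP; exists [seq summand l m a | a <- enum 'I_(k m l)].
  by apply/mapP; exists m; rewrite // mem_enum.
by apply/mapP; exists a; rewrite // mem_enum.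
Qed.
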